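(* Let $(\Omega,\mathcal{A},\mu)$ be a $\sigma$-finite measure space and let $p(\cdot):\Omega\to[1,\infty]$ be an exponent function with $\mu(\{p=\infty\})=0$ and $p_+=\infty$. Then the dual space $(L^{p(\cdot)})^*$ is isomorphic to the external direct sum $L^{p'(\cdot)}\oplus (L^{p(\cdot)}_{\mathrm{germ}})^*$.
   Context: Functions are real-valued, measurable, and identified when equal $\mu$-a.e. An exponent function is a measurable function $q(\cdot):\Omega\to[1,\infty]$. With $\Omega_\infty^q=\{x: q(x)=\infty\}$, the modular is $\rho_{q(\cdot)}(f)=\int_{\Omega\setminus\Omega_\infty^q}|f(x)|^{q(x)}\,d\mu(x)+\|f\|_{L^\infty(\Omega_\infty^q)}$. The space $L^{q(\cdot)}=L^{q(\cdot)}(\Omega)$ consists of all $f$ with $\rho_{q(\cdot)}(f/\lambda)<\infty$ for some $\lambda>0$, with the Luxemburg norm $\|f\|_{q(\cdot)}=\inf\{\lambda>0:\rho_{q(\cdot)}(f/\lambda)\le 1\}$; it is a Banach space. The dual exponent $p'(\cdot)$ is defined pointwise by $\frac1{p(x)}+\frac1{p'(x)}=1$, with $1/\infty=0$. For measurable $E\subseteq\Omega$, $p_+(E)=\operatorname{ess\,sup}_{x\in E}p(x)$, and $p_+=p_+(\Omega)$. Let $L^{p(\cdot)}_b=\{f\in L^{p(\cdot)}: p_+(\operatorname{supp} f)<\infty\}$, where $\operatorname{supp} f=\{f\ne0\}$ (null sets count as having $p_+<\infty$), and let $\overline{L^{p(\cdot)}_b}$ be its closure in $L^{p(\cdot)}$.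 The germ space is the quotient $L^{p(\cdot)}_{\mathrm{germ}}=L^{p(\cdot)}/\overline{L^{p(\cdot)}_b}$ with the quotient norm. ''Isomorphic'' means there is a bounded linear bijection with bounded inverse. *)

(* Defs.v *)
From HB Require Import structures.
From mathcomp Require Import all_boot all_order all_algebra.
From mathcomp Require Import all_classical all_reals all_analysis.
From mathcomp Require Import ess_sup_inf measurable_realfun.
Set Implicit Arguments.
Unset Strict Implicit.
Unset Printing Implicit Defensive.
Import Order.TTheory GRing.Theory Num.Def Num.Theory.
Import numFieldNormedType.Exports.
Local Open Scope classical_set_scope.
Local Open Scope ring_scope.

Record exponent d (T : measurableType d) (R : realType) := Exponent {
  exponent_fun :> T -> \bar R;
  exponent_measurable : measurable_fun [set: T] exponent_fun;
  exponent_ge1 : forall x, (1 <= exponent_fun x)%E }.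

Section modular.
Context d (T : measurableType d) (R : realType).
Variables (mu : {measure set T -> \bar R}) (q : exponent T R).
Implicit Types (f g : T -> R) (l k : R).
Local Open Scope ereal_scope.

(* The L^oo norm over {q = +oo} is the L^oo norm over T of the extension by
   zero; the library's Lnorm at +oo is 0 when mu is the zero measure *)
Definition modular f : \bar R :=
  \int[mu]_(x in [set x | q x != +oo]) (`|f x| `^ fine (q x))%:E +
  'N[mu]_+oo[EFin \o (f \_ [set x | q x = +oo])].

Let Dfin := [set x | q x != +oo].
Let Doo := [set x | q x = +oo].

Lemma measurable_exponent_oo : measurable [set x | q x = +oo].
Proof.
rewrite (_ : [set x | _] = setT `&` q @^-1` [set +oo]); last by rewrite setTI.
exact: (exponent_measurable q).
Qed.
Let mDoo := measurable_exponent_oo.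

Lemma measurable_exponent_fin : measurable [set x | q x != +oo].
Proof.
rewrite (_ : [set x | _] = ~` [set x | q x = +oo]); first exact: measurableC.
by apply/seteqP; split=> x /= /eqP.
Qed.
Let mDfin := measurable_exponent_fin.

Let measurable_fineq : measurable_fun [set: T] (fine \o q).
Proof.
apply: (measurableT_comp (fine_measurable _)) => //.
exact: exponent_measurable.
Qed.

Lemma measurable_powR2 (f g : T -> R) : measurable_fun setT f ->
  measurable_fun setT g -> measurable_fun setT (fun x => f x `^ g x)%R.
Proof.
move=> mf mg.
apply: measurable_fun_ifT => /=.
- exact: measurable_fun_eqr.
- by apply: measurableT_comp => //; exact: measurable_fun_eqr.
- apply: measurableT_comp => //; apply: measurable_funM => //.
  by apply: measurableT_comp => //; exact: measurable_ln.
Qed.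

Lemma fineq_ge1 x : Dfin x -> (1 <= fine (q x))%R.
Proof.
rewrite /Dfin /=; have := exponent_ge1 q x.
by case: (q x) => // r; rewrite lee_fin.
Qed.

Let mpow f : measurable_fun setT f ->
  measurable_fun Dfin (fun x => (`|f x| `^ fine (q x))%:E).
Proof.
move=> mf; apply/measurable_EFinP; apply: measurable_funTS.
by apply: measurable_powR2 => //; exact: measurableT_comp.
Qed.

Lemma modular_ge0 f : 0 <= modular f.
Proof.
apply: adde_ge0; last exact: Lnorm_ge0.
by apply: integral_ge0 => x _; rewrite lee_fin powR_ge0.
Qed.

Lemma eq_modular f g : measurable_fun setT f -> measurable_fun setT g ->
  (\forall x \ae mu, `|f x| = `|g x|)%R -> modular f = modular g.
Proof.
move=> mf mg fg; congr (_ + _).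
  apply: ae_eq_integral => //; [exact: mpow|exact: mpow|].
  by apply: filterS fg => x -> _.
rewrite unlock; case: ifPn => // _; apply: eq_ess_sup.
apply: filterS fg => x fg /=; congr EFin.
by rewrite /patch; case: ifP.
Qed.

Lemma modular0 : modular (cst 0%R) = 0.
Proof.
rewrite /modular (_ : EFin \o _ = cst 0); last first.
  by apply/funext => x /=; rewrite /patch; case: ifP.
rewrite Lnorm0// adde0 integral0_eq// => x Dx.
by rewrite normr0 powR0// gt_eqF// (lt_le_trans _ (fineq_ge1 Dx)).
Qed.

Lemma convex_pow (r a b x y : R) : (1 <= r -> 0 <= a -> 0 <= b -> a + b = 1 ->
  `|a * x + b * y| `^ r <= a * `|x| `^ r + b * `|y| `^ r)%R.
Proof.
move=> r1 a0 b0 ab1.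
have a1 : (a <= 1)%R by rewrite -ab1 lerDl.
have -> : b = (1 - a)%R by rewrite -ab1 addrC addKr.
have := @convex_powR R r r1 (Itv01 a0 a1) `|x|%R `|y|%R.
rewrite !inE/= !in_itv/= !andbT !normr_ge0 => /(_ isT isT).
rewrite !convRE/= /unstable.onem; apply: le_trans.
apply: ge0_ler_powR; rewrite ?nnegrE//.
- exact: le_trans r1.
- by apply: addr_ge0; apply: mulr_ge0; rewrite ?subr_ge0.
- by rewrite (le_trans (ler_normD _ _))// !normrM (ger0_norm a0) (@ger0_norm _ (1 - a)%R)// subr_ge0.
Qed.

Lemma modular_convex f g (a b : R) :
  measurable_fun setT f -> measurable_fun setT g ->
  (0 <= a -> 0 <= b -> a + b = 1)%R ->
  (0 <= a)%R -> (0 <= b)%R ->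
  modular (fun x => a * f x + b * g x)%R <=
  a%:E * modular f + b%:E * modular g.
Proof.
move=> mf mg /[swap] a0 /[swap] b0 /(_ a0 b0) ab1.
have I0 (h : T -> R) : 0 <= \int[mu]_(x in Dfin) (`|h x| `^ fine (q x))%:E.
  by apply: integral_ge0 => x _; rewrite lee_fin powR_ge0.
rewrite /modular (ge0_muleDr _ (I0 f) (Lnorm_ge0 _ _ _)).
rewrite (ge0_muleDr _ (I0 g) (Lnorm_ge0 _ _ _)) addeACA; apply: leeD.
  rewrite -!ge0_integralZl//; try exact: mpow;
    try (by move=> x _; rewrite lee_fin powR_ge0).
  rewrite -ge0_integralD//; first last.
  - apply: measurable_funeM; exact: mpow.
  - by move=> x _; rewrite -EFinM lee_fin mulr_ge0// powR_ge0.
  - apply: measurable_funeM; exact: mpow.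
  - by move=> x _; rewrite -EFinM lee_fin mulr_ge0// powR_ge0.
  apply: ge0_le_integral => //.
  - apply: (@mpow (fun x => (a * f x + b * g x)%R)); apply: measurable_funD; exact: measurable_funM.
  - by apply: emeasurable_funD; apply: measurable_funeM; exact: mpow.
  - move=> x Dx; rewrite -!EFinM -EFinD lee_fin.
    by apply: convex_pow => //; exact: fineq_ge1.
rewrite unlock; case: ifPn => [mu0|_]; last by rewrite !mule0 adde0.
apply/ess_supP.
set F := abse \o (EFin \o (f \_ _)); set G := abse \o (EFin \o (g \_ _)).
near=> x.
have fx : F x <= ess_sup mu F by near: x; exact: ess_sup_ge.
have gx : G x <= ess_sup mu G by near: x; exact: ess_sup_ge.
apply: (@le_trans _ _ (a%:E * F x + b%:E * G x)); last first.
  by apply: leeD; rewrite lee_wpmul2l ?lee_fin//.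
rewrite /F /G /= -!EFinM -EFinD lee_fin /patch; case: ifP => _.
  by rewrite (le_trans (ler_normD _ _))// !normrM (ger0_norm a0) (ger0_norm b0).
by rewrite normr0 !mulr0 addr0.
Unshelve. all: by end_near. Qed.

Lemma modular_eq0 f : measurable_fun setT f -> modular f = 0 ->
  \forall x \ae mu, f x = 0%R.
Proof.
move=> mf /eqP; rewrite padde_eq0 ?Lnorm_ge0//; first last.
  by apply: integral_ge0 => x _; rewrite lee_fin powR_ge0.
move=> /andP[/eqP I0 /eqP S0].
have [/(_ _)] := ae_eq_integral_abs mu mDfin (mpow mf).
rewrite (eq_integral (fun x => (`|f x| `^ fine (q x))%:E)); last first.
  by move=> x _; rewrite gee0_abs// lee_fin powR_ge0.
move=> /(_ I0) I0' _.
have mr : measurable_fun setT (EFin \o (f \_ Doo)).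
  apply/measurable_EFinP; apply/(measurable_restrictT _ _).1 => //.
  exact: measurable_funTS.
have /(_ (ltry _)) S0' := Lnorm_eq0_eq0 mr _ S0.
near=> x.
have Ix : Dfin x -> (`|f x| `^ fine (q x))%:E = 0 by near: x; exact: I0'.
have Sx : (EFin \o (f \_ Doo)) x = 0.
  by near: x; apply: filterS S0' => x /(_ I).
have [qoo|qfin] := eqVneq (q x) +oo.
  by move: Sx => /= [] ; rewrite patchE mem_set.
by move: (Ix qfin) => [] /eqP; rewrite powR_eq0 normr_eq0 => /andP[/eqP].
Unshelve. all: by end_near. Qed.

End modular.

(* luxemburg is only meaningful on vLfun: inf set0 = 0 *)
Section luxemburg.
Context d (T : measurableType d) (R : realType).
Variables (mu : {measure set T -> \bar R}) (q : exponent T R).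
Implicit Types (f g : T -> R) (l k c : R).

Definition luxemburg f : R :=
  inf [set l | 0 < l /\ (modular mu q (fun x => f x / l)%R <= 1)%E].

Definition vLfun : {pred T -> R^o} := [pred f : T -> R | `[< measurable_fun setT f /\
  exists2 l, 0 < l & (modular mu q (fun x => f x / l)%R < +oo)%E >]].

Let A (f : T -> R) (l : R) := 0 < l /\ (modular mu q (fun x => f x / l)%R <= 1)%E.

Let mdiv (f : T -> R) (l : R) : measurable_fun setT f -> measurable_fun setT (fun x => f x / l).
Proof. by move=> mf; apply: measurable_funM. Qed.

Lemma modular_scale (f : T -> R) (c : R) : measurable_fun setT f -> 0 <= c <= 1 ->
  (modular mu q (fun x => c * f x)%R <= c%:E * modular mu q f)%E.
Proof.
move=> mf /andP[c0 c1].
have := @modular_convex _ _ _ mu q f (cst 0) c (1 - c) mf (measurable_cst _)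
  (fun _ _ => subrKC _ _) c0.
rewrite subr_ge0 => /(_ c1); rewrite modular0 mule0 adde0.
by under eq_fun do rewrite mulr0 addr0.
Qed.

Lemma vLfunP (f : T -> R) : f \in vLfun <-> measurable_fun setT f /\
  exists l, 0 < l /\ (modular mu q (fun x => f x / l)%R <= 1)%E.
Proof.
split=> [/asboolP[mf [l l0 ml]]|[mf [l [l0 ml]]]]; last first.
  by apply/asboolP; split=> //; exists l => //; rewrite (le_lt_trans ml)// ltry.
split=> //; set m := modular _ _ _ in ml.
have mfin : m \is a fin_num by rewrite ge0_fin_numE// modular_ge0.
have M0 : 0 < Num.max 1 (fine m) by rewrite lt_max ltr01.
exists (l * Num.max 1 (fine m)); split; first exact: mulr_gt0.
rewrite (_ : (fun x => _) =
    (fun x => (Num.max 1 (fine m))^-1 * (f x / l))); last first.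
  by apply/funext => x; rewrite invfM mulrA mulrC.
rewrite (le_trans (modular_scale _ _))//; first exact: mdiv.
  by rewrite invr_ge0 (ltW M0) invf_le1// le_max lexx.
by rewrite -/m -(fineK mfin) -EFinM lee_fin mulrC ler_pdivrMr// mul1r le_max lexx orbT.
Qed.

Let AD (f : T -> R) g l k : measurable_fun setT f -> measurable_fun setT g ->
  A f l -> A g k -> A (fun x => f x + g x) (l + k).
Proof.
move=> mf mg [l0 ml] [k0 mk]; split; first exact: addr_gt0.
have lk0 : 0 < l + k by exact: addr_gt0.
have lk : l / (l + k) + k / (l + k) = 1 by rewrite -mulrDl divff// gt_eqF.
have a0 : 0 <= l / (l + k) by apply: divr_ge0; exact: ltW.
have b0 : 0 <= k / (l + k) by apply: divr_ge0; exact: ltW.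
rewrite (_ : (fun x => _) = (fun x => l / (l + k) * (f x / l) +
    k / (l + k) * (g x / k))); last first.
  apply/funext => x; rewrite mulrAC mulrCA divff ?gt_eqF// mulr1.
  by rewrite [X in _ = _ + X]mulrAC mulrCA divff ?gt_eqF// mulr1 -mulrDl.
rewrite (le_trans (modular_convex mu q (mdiv l mf) (mdiv k mg) (fun _ _ => lk) a0 b0))//.
rewrite -[leRHS]/(1%:E) -[in leRHS]lk EFinD leeD//.
  by rewrite -[leRHS]mule1 lee_wpmul2l// lee_fin.
by rewrite -[leRHS]mule1 lee_wpmul2l// lee_fin.
Qed.

Let AZ (f : T -> R) l c : measurable_fun setT f -> c != 0 ->
  A f l -> A (fun x => c * f x) (`|c| * l).
Proof.
move=> mf c0 [l0 ml]; split; first by rewrite mulr_gt0 ?normr_gt0.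
suff -> : modular mu q (fun x => c * f x / (`|c| * l)) =
    modular mu q (fun x => f x / l) by [].
apply: eq_modular; [apply: mdiv; exact: measurable_funM|exact: mdiv|].
apply: nearW => x; rewrite invfM !normrM !normfV normr_id.
by rewrite mulrACA mulfV ?normr_eq0// mul1r.
Qed.

Let A0 l : 0 < l -> A (cst 0) l.
Proof.
move=> l0; split=> //; under eq_fun do rewrite mul0r.
by rewrite modular0 lee_fin.
Qed.

Lemma vLfun_submod_closed : submod_closed vLfun.
Proof.
split; first by apply/vLfunP; split; [exact: measurable_cst|exists 1; exact: A0].
move=> c f g /vLfunP[mf [l Al]] /vLfunP[mg [k Ak]].
have mcf : measurable_fun setT (c *: f : T -> R) by exact: measurable_funM.
apply/vLfunP; split; first exact: measurable_funD.
have [->|c0] := eqVneq c 0.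
  by exists k; rewrite scale0r add0r.
exists (`|c| * l + k); apply: (@AD (c *: f) g) => //; exact: AZ.
Qed.

Let Alb (f : T -> R) : has_lbound (A f).
Proof. by exists 0 => l [/ltW]. Qed.

Lemma luxemburg_measurable f : f \in vLfun -> measurable_fun setT f.
Proof. by move=> /vLfunP[]. Qed.

Lemma luxemburg_ge0 f : f \in vLfun -> 0 <= luxemburg f.
Proof. by move=> /vLfunP[mf Af]; apply: lb_le_inf => // l [/ltW]. Qed.

Lemma luxemburgD f g : f \in vLfun -> g \in vLfun ->
  luxemburg (fun x => f x + g x) <= luxemburg f + luxemburg g.
Proof.
move=> /vLfunP[mf Af] /vLfunP[mg Ag].
rewrite -lerBlDr; apply: lb_le_inf => // l Al.
rewrite lerBlDr addrC -lerBlDr; apply: lb_le_inf => // k Ak.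
by rewrite lerBlDr addrC; apply: ge_inf; [exact: Alb|exact: AD].
Qed.

Lemma luxemburg0 : luxemburg (cst 0) = 0.
Proof.
apply/eqP; rewrite eq_le; apply/andP; split.
  by apply/ler_addgt0Pr => e e0; rewrite add0r; apply: ge_inf; [exact: Alb|exact: A0].
by apply: lb_le_inf; [exists 1; exact: A0|move=> l [/ltW]].
Qed.

Lemma luxemburgZ c f : f \in vLfun -> luxemburg (fun x => c * f x) = `|c| * luxemburg f.
Proof.
have le (k : R) g : k != 0 -> g \in vLfun -> luxemburg (fun x => k * g x) <= `|k| * luxemburg g.
  move=> k0 /vLfunP[mg Ag]; rewrite mulrC -ler_pdivrMr ?normr_gt0//.
  apply: lb_le_inf => // l Al; rewrite ler_pdivrMr ?normr_gt0// mulrC.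
  by apply: ge_inf; [exact: Alb|exact: AZ].
move=> fV; have [->|c0] := eqVneq c 0.
  rewrite normr0 mul0r -[RHS]luxemburg0; congr luxemburg.
  by apply/funext => x; rewrite mul0r.
apply/eqP; rewrite eq_le le//= -ler_pdivlMl ?normr_gt0// -normfV.
have cf : (fun x => c * f x) \in vLfun.
  have [mf [l Al]] := (vLfunP f).1 fV.
  by apply/vLfunP; split; [exact: measurable_funM|exists (`|c| * l); exact: AZ].
have := le c^-1 _ _ cf; rewrite invr_eq0 => /(_ c0).
by rewrite (_ : (fun x => _) = f)//; apply/funext => x; rewrite mulKf.
Qed.

Lemma luxemburg_eq0 f : f \in vLfun -> luxemburg f = 0 ->
  \forall x \ae mu, f x = 0.
Proof.
move=> fV lf0; have /vLfunP[mf Af] := fV.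
apply: (@modular_eq0 _ _ _ mu q _ mf); apply/eqP; rewrite eq_le modular_ge0 andbT.
apply/lee_addgt0Pr => e e0; rewrite add0e.
pose e1 := Num.min e 1.
have e10 : 0 < e1 by rewrite lt_min e0 ltr01.
have [l Al le] : exists2 l, A f l & l < e1.
  have : luxemburg f < e1 by rewrite lf0.
  by move=> /inf_lt -/(_ (Af))[l Al le]; exists l.
have [l0 ml] := Al.
rewrite (_ : f = (fun x => l * (f x / l))); last first.
  by apply/funext => x; rewrite mulrCA divff ?mulr1 ?gt_eqF.
rewrite (le_trans (modular_scale _ _))//; first exact: mdiv.
  by rewrite (ltW l0)/= (le_trans (ltW le))// ge_min lexx orbT.
rewrite (@le_trans _ _ l%:E)//.
  by rewrite -[leRHS]mule1 lee_wpmul2l// lee_fin ltW.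
by rewrite lee_fin (le_trans (ltW le))// ge_min lexx.
Qed.

End luxemburg.

Section quotient_space.
Variables (R : pzRingType) (V : lmodType R).

Record subspace := Subspace {
  subspace_set :> set V;
  subspace0 : subspace_set 0;
  subspace_lin : forall a u v,
    subspace_set u -> subspace_set v -> subspace_set (a *: u + v) }.

Variable W : subspace.

Definition subspace_pred : {pred V} := [pred v | `[< subspace_set W v >]].

Lemma subspace_predP v : reflect (subspace_set W v) (v \in subspace_pred).
Proof. exact: asboolP. Qed.

Let subspace_zmod : zmod_closed subspace_pred.
Proof.
split; first exact/subspace_predP/subspace0.
move=> u v /subspace_predP Wu /subspace_predP Wv; apply/subspace_predP.
by rewrite addrC -scaleN1r; exact: subspace_lin.
Qed.

HB.instance Definition _ := GRing.isZmodClosed.Build V subspace_pred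
  subspace_zmod.

Definition quotient_space : Type := Quotient.quot subspace_pred.

HB.instance Definition _ := Choice.on quotient_space.
HB.instance Definition _ := EqQuotient.on quotient_space.
HB.instance Definition _ := GRing.Zmodule.on quotient_space.
HB.instance Definition _ := ZmodQuotient.on quotient_space.

Local Notation Q := quotient_space.
Local Open Scope quotient_scope.

Lemma quot_eqP u v : \pi_Q u = \pi_Q v <-> subspace_set W (u - v).
Proof.
split=> [/eqP|/subspace_predP uv]; last first.
  by apply/eqP; rewrite -[_ == _]Quotient.idealrBE.
by rewrite -[_ == _]Quotient.idealrBE => /subspace_predP.
Qed.

Definition quot_scale (a : R) (x : Q) : Q := \pi_Q (a *: repr x).

Lemma pi_quot_scale a v : \pi_Q (a *: v) = quot_scale a (\pi_Q v).
Proof.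
apply/quot_eqP; rewrite -scalerBr -[a *: _]addr0; apply: subspace_lin.
  by apply/quot_eqP; rewrite reprK.
exact: subspace0.
Qed.

Let quot_scalerA a b x : quot_scale a (quot_scale b x) = quot_scale (a * b) x.
Proof. by elim/quotW: x => v; rewrite -(pi_quot_scale b v) -!pi_quot_scale scalerA. Qed.

Let quot_scale1r : left_id 1 quot_scale.
Proof. by elim/quotW=> v; rewrite -!pi_quot_scale scale1r. Qed.

Let quot_scalerDr : right_distributive quot_scale +%R.
Proof.
move=> a; elim/quotW=> u; elim/quotW=> v.
by rewrite -raddfD -!pi_quot_scale -raddfD scalerDr.
Qed.

Let quot_scalerDl x : {morph quot_scale^~ x : a b / a + b}.
Proof. by elim/quotW: x => v a b; rewrite -!pi_quot_scale scalerDl -raddfD. Qed.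

HB.instance Definition _ := GRing.Zmodule_isLmodule.Build R Q
  quot_scalerA quot_scale1r quot_scalerDr quot_scalerDl.

Lemma quot_piZ a v : \pi_Q (a *: v) = a *: \pi_Q v.
Proof. exact: pi_quot_scale. Qed.

Lemma quot_piD u v : \pi_Q (u + v) = \pi_Q u + \pi_Q v.
Proof. exact: raddfD. Qed.

End quotient_space.

Section normed_quotient.
Variables (R : realType) (V : normedModType R).

Lemma closure_approx (A : set V) v : closure A v <->
  forall e : R, 0 < e -> exists2 w, A w & `|v - w| < e.
Proof.
split=> [cv e e0|h B /nbhs_ballP[e e0 eB]].
  have [w [Aw]] := cv _ (nbhsx_ballx v e e0).
  by rewrite -ball_normE; exists w.
by have [w Aw vw] := h _ e0; exists w; split=> //; apply: eB; rewrite -ball_normE.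
Qed.

Lemma closure_subspace0 (W : subspace V) : closure W 0.
Proof. by apply: subset_closure; exact: subspace0. Qed.

Lemma closure_subspace_lin (W : subspace V) a u v :
  closure W u -> closure W v -> closure W (a *: u + v).
Proof.
move=> /closure_approx cu /closure_approx cv; apply/closure_approx => e e0.
have a0 : 0 < `|a| + 1 by rewrite ltr_wpDl.
have [u' Wu' uu'] := cu (e / 2 / (`|a| + 1)) (divr_gt0 (divr_gt0 e0 (ltr0Sn _ _)) a0).
have [v' Wv' vv'] := cv (e / 2) (divr_gt0 e0 (ltr0Sn _ _)).
exists (a *: u' + v'); first exact: subspace_lin.
rewrite opprD addrACA -scalerBr (le_lt_trans (ler_normD _ _))// [ltRHS]splitr.
rewrite ler_ltD// normrZ; move/ltW : uu'; rewrite ler_pdivlMr// => /(le_trans _); apply.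
by rewrite mulrC ler_wpM2l// lerDl.
Qed.

Definition closure_subspace (W : subspace V) : subspace V :=
  Subspace (closure_subspace0 W) (@closure_subspace_lin W).

Variables (W : subspace V) (cW : closed (subspace_set W)).

(* closedness of W is recorded in the type because the quotient seminorm is a
   norm only then *)
Definition normed_quotient (_ : closed (subspace_set W)) : Type :=
  quotient_space W.
Local Notation Q := (normed_quotient cW).

HB.instance Definition _ := Choice.on Q.
HB.instance Definition _ := EqQuotient.on Q.
HB.instance Definition _ := GRing.Lmodule.on Q.

Local Open Scope quotient_scope.

Definition quotient_norm (x : Q) : R := inf [set `|v| | v in [set v | \pi_Q v = x]].

Let lbN (x : Q) : has_lbound [set `|v| | v in [set v : V | \pi_Q v = x]].
Proof. by exists 0 => _ [v _ <-]. Qed.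

Let neN (x : Q) : [set `|v| | v in [set v : V | \pi_Q v = x]] !=set0.
Proof. by exists `|repr x|, (repr x) => //=; rewrite reprK. Qed.

Let quotient_normD x y :
  quotient_norm (x + y) <= quotient_norm x + quotient_norm y.
Proof.
rewrite -lerBlDr; apply: lb_le_inf; first exact: neN.
move=> _ [u /= ux <-]; rewrite lerBlDr [leRHS]addrC -lerBlDr.
apply: lb_le_inf; first exact: neN.
move=> _ [v /= vy <-]; rewrite lerBlDr.
apply: (le_trans _ (ler_normD _ _)); apply: ge_inf; first exact: lbN.
by exists (v + u) => //=; rewrite -ux -vy [RHS]addrC; exact: quot_piD.
Qed.

Let quotient_normZ (a : R) x : quotient_norm (a *: x) = `|a| * quotient_norm x.
Proof.
have le (k : R) y : k != 0 -> quotient_norm (k *: y) <= `|k| * quotient_norm y.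
  move=> k0; rewrite mulrC -ler_pdivrMr ?normr_gt0//.
  apply: lb_le_inf; first exact: neN.
  move=> _ [v /= vy <-]; rewrite ler_pdivrMr ?normr_gt0// mulrC -normrZ.
  apply: ge_inf; first exact: lbN.
  by exists (k *: v) => //=; rewrite -vy; exact: quot_piZ.
have [->|a0] := eqVneq a 0.
  rewrite normr0 mul0r scale0r; apply/eqP; rewrite eq_le; apply/andP; split.
    by apply: ge_inf; [exact: lbN|exists 0; rewrite ?normr0//=; exact: raddf0].
  by apply: lb_le_inf; [exact: neN|move=> _ [v _ <-]].
apply/eqP; rewrite eq_le le//= -ler_pdivlMl ?normr_gt0// -normfV.
by have := le a^-1 (a *: x); rewrite invr_eq0 scalerK// => /(_ a0).
Qed.

Let quotient_norm_eq0 x : quotient_norm x = 0 -> x = 0.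
Proof.
move=> x0; rewrite -[x]reprK -[RHS](raddf0 (\pi_(quotient_space W))).
apply/quot_eqP; rewrite subr0; apply: cW; apply/closure_approx => e e0.
have : quotient_norm x < e by rewrite x0.
move=> /inf_lt -/(_ (neN x))[_ [v /= vx <-] ve].
exists (repr x - v); last by rewrite subKr.
by apply/quot_eqP; rewrite reprK.
Qed.

HB.instance Definition _ := Lmodule_isNormed.Build R Q
  quotient_normD quotient_normZ quotient_norm_eq0.

End normed_quotient.

Section bounded_maps.
Variable R : realType.

Definition bounded_map (V W : normedModType R) (f : V -> W) : Prop :=
  exists C : R, forall x, `|f x| <= C * `|x|.

Definition isomorphic (V W : normedModType R) : Prop :=
  exists (f : {linear V -> W}) (g : W -> V),
    [/\ cancel f g, cancel g f, bounded_map f & bounded_map g].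

Variable V : normedModType R.

Definition functional_pred : {pred V -> R^o} :=
  [pred f : V -> R^o | `[< linear f /\ bounded_map f >]].

Let functional_submod : submod_closed functional_pred.
Proof.
split.
  apply/asboolP; split; first by move=> a u v /=; rewrite scaler0 addr0.
  by exists 0 => x; rewrite normr0 mul0r.
move=> a f g /asboolP[lf [C fC]] /asboolP[lg [D gD]]; apply/asboolP; split.
  move=> b u v; rewrite !fctE lf lg !scalerDr !scalerA mulrC.
  by rewrite addrACA.
exists (`|a| * C + D) => x; rewrite mulrDl -mulrA.
rewrite (le_trans (ler_normD _ _))// lerD//.
by rewrite normrZ ler_wpM2l.
Qed.

HB.instance Definition _ := GRing.isSubmodClosed.Build R (V -> R^o) functional_pred
  functional_submod.

Record dual := Dual {
  dual_fun :> V -> R^o;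
  dual_funP : dual_fun \in functional_pred }.

HB.instance Definition _ := [isSub for dual_fun].
HB.instance Definition _ := [Choice of dual by <:].
HB.instance Definition _ := [SubChoice_isSubLmodule of dual by <:].

(* operator norm *)
Definition dual_norm (f : dual) : R := sup [set `|f x| | x in [set x | `|x| <= 1]].

Let neD (f : dual) : [set `|f x| | x in [set x | `|x| <= 1]] !=set0.
Proof. by exists `|f 0|, 0 => //=; rewrite normr0. Qed.

Let ubD (f : dual) : has_ubound [set `|f x| | x in [set x | `|x| <= 1]].
Proof.
have /asboolP[_ [C fC]] := dual_funP f; exists `|C| => _ [x /= x1 <-].
rewrite (le_trans (fC x))// (le_trans (ler_norm _))// normrM normr_id.
by rewrite ler_piMr.
Qed.

Let dual_normD f g : dual_norm (f + g) <= dual_norm f + dual_norm g.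
Proof.
apply: ge_sup; first exact: neD.
move=> _ [x x1 <-]; rewrite (le_trans (ler_normD _ _))// lerD//.
  by apply: ub_le_sup; [exact: ubD|exists x].
by apply: ub_le_sup; [exact: ubD|exists x].
Qed.

Let dual_normZ (a : R) f : dual_norm (a *: f) = `|a| * dual_norm f.
Proof.
have le (k : R) g : dual_norm (k *: g) <= `|k| * dual_norm g.
  apply: ge_sup; first exact: neD.
  move=> _ [x x1 <-]; rewrite [`|_|]normrZ ler_wpM2l//.
  by apply: ub_le_sup; [exact: ubD|exists x].
have [->|a0] := eqVneq a 0.
  apply/eqP; rewrite eq_le le/= normr0 mul0r.
  apply: (@le_trans _ _ `|(0 *: f : dual) 0|) => //.
  by apply: ub_le_sup; [exact: ubD|exists 0; rewrite //= normr0].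
apply/eqP; rewrite eq_le le//= -ler_pdivlMl ?normr_gt0// -normfV.
by have := le a^-1 (a *: f); rewrite scalerK.
Qed.

Let dual_norm_eq0 f : dual_norm f = 0 -> f = 0.
Proof.
move=> f0; apply: val_inj; apply/funext => x /=.
have /asboolP[lf _] := dual_funP f.
pose F : {linear V -> R^o} := HB.pack (dual_fun f) (GRing.isLinear.Build _ _ _ _ _ lf).
have f1 y : `|y| <= 1 -> f y = 0.
  move=> y1; apply/eqP; rewrite -normr_le0 -f0.
  by apply: ub_le_sup; [exact: ubD|exists y].
have [->|x0] := eqVneq x 0; first exact: (linear0 F).
have := f1 (`|x|^-1 *: x); rewrite normrZ normfV normr_id mulVf ?normr_eq0//.
move=> /(_ (lexx _)).
have := lf `|x|^-1 x 0; rewrite addr0 [f 0](linear0 F) addr0 => -> /eqP.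
by rewrite scaler_eq0 invr_eq0 normr_eq0 (negbTE x0)/= => /eqP.
Qed.

HB.instance Definition _ := Lmodule_isNormed.Build R dual
  dual_normD dual_normZ dual_norm_eq0.

End bounded_maps.

Section vLspace.
Context d (T : measurableType d) (R : realType).
Variables (mu : {measure set T -> \bar R}) (q : exponent T R).

Record vLfunType := VLfun {
  vLfun_fun :> T -> R^o;
  vLfun_funP : vLfun_fun \in vLfun mu q }.

HB.instance Definition _ :=
  GRing.isSubmodClosed.Build R (T -> R^o) (vLfun mu q)
    (vLfun_submod_closed mu q).
HB.instance Definition _ := [isSub for vLfun_fun].
HB.instance Definition _ := [Choice of vLfunType by <:].
HB.instance Definition _ := [SubChoice_isSubLmodule of vLfunType by <:].

Definition vL_null : set vLfunType := [set f | \forall x \ae mu, f x = 0].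

Lemma vL_null0 : vL_null 0.
Proof. exact: nearW. Qed.

Lemma vL_null_lin a f g : vL_null f -> vL_null g -> vL_null (a *: f + g).
Proof.
rewrite /vL_null/=; apply: filterS2 => x fx gx.
by rewrite [LHS](_ : _ = a *: f x + g x)// fx gx scaler0 addr0.
Qed.

Definition vL_null_subspace := Subspace vL_null0 vL_null_lin.

Definition vLspace : Type := quotient_space vL_null_subspace.

HB.instance Definition _ := Choice.on vLspace.
HB.instance Definition _ := EqQuotient.on vLspace.
HB.instance Definition _ := GRing.Lmodule.on vLspace.

Local Open Scope quotient_scope.

Definition vL_norm (F : vLspace) : R := luxemburg mu q (repr F).

Lemma eq_luxemburg (f g : T -> R) : measurable_fun setT f -> measurable_fun setT g ->
  (\forall x \ae mu, f x = g x) -> luxemburg mu q f = luxemburg mu q g.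
Proof.
move=> mf mg fg; congr inf; apply/seteqP.
have E l : modular mu q (fun x => f x / l)%R = modular mu q (fun x => g x / l)%R.
  apply: eq_modular; [exact: measurable_funM|exact: measurable_funM|].
  by apply: filterS fg => x ->.
by split=> l /= []; rewrite E.
Qed.

Lemma measurable_vLfun (f : vLfunType) : measurable_fun setT (f : T -> R).
Proof. exact: luxemburg_measurable (vLfun_funP f). Qed.

Lemma vL_normE (f : vLfunType) : vL_norm (\pi f) = luxemburg mu q f.
Proof.
apply: eq_luxemburg; [exact: measurable_vLfun|exact: measurable_vLfun|].
have : vL_null (repr (\pi_vLspace f) - f).
  by apply/(quot_eqP vL_null_subspace); rewrite reprK.
by apply: filterS => x fx; apply/eqP; rewrite -subr_eq0; apply/eqP.
Qed.

Let vL_normD F G : vL_norm (F + G) <= vL_norm F + vL_norm G.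
Proof.
rewrite -{1}[F]reprK -{1}[G]reprK -[X in vL_norm X](quot_piD vL_null_subspace) vL_normE.
exact: luxemburgD (vLfun_funP _) (vLfun_funP _).
Qed.

Let vL_normZ (a : R) F : vL_norm (a *: F) = `|a| * vL_norm F.
Proof.
rewrite -{1}[F]reprK -[X in vL_norm X](quot_piZ vL_null_subspace) vL_normE.
exact: luxemburgZ (vLfun_funP _).
Qed.

Let vL_norm_eq0 F : vL_norm F = 0 -> F = 0.
Proof.
move=> /(luxemburg_eq0 (vLfun_funP _)) F0.
rewrite -[F]reprK -[RHS](raddf0 (\pi_(quotient_space vL_null_subspace))).
by apply/quot_eqP; rewrite subr0.
Qed.

HB.instance Definition _ := Lmodule_isNormed.Build R vLspace
  vL_normD vL_normZ vL_norm_eq0.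

(* The extension of q by 0 outside E has the same essential supremum as q on E
   when mu E > 0, because q >= 1; for null E the value is at most 0, in
   particular < +oo *)
Definition exponent_sup (E : set T) : \bar R := ess_sup mu (q \_ E).

(* The condition does not depend on the representative, see vLbP *)
Definition vLb : set vLspace :=
  [set F | (exponent_sup [set x | (repr F : vLfunType) x != 0%R] < +oo)%E].

Lemma exponent_sup_lty (E : set T) : (exponent_sup E < +oo)%E <->
  exists M : R, \forall x \ae mu, E x -> (q x <= M%:E)%E.
Proof.
split=> [Eoo|[M EM]].
  have [M EM] : exists M : R, (exponent_sup E <= M%:E)%E.
    case: (exponent_sup E) Eoo => [r||]//=; last by exists 0; rewrite leNye.
    by exists r.
  exists M; move/ess_supP: EM; apply: filterS => x.
  by rewrite patchE => + Ex; rewrite mem_set.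
apply: (@le_lt_trans _ _ (Num.max M 0)%:E); last exact: ltry.
apply/ess_supP; apply: filterS EM => x; rewrite patchE.
case: ifPn => [/set_mem Ex /(_ Ex) h|_ _]; last by rewrite lee_fin le_max lexx orbT.
by rewrite (le_trans h)// lee_fin le_max lexx.
Qed.

Lemma vLbP (f : vLfunType) : vLb (\pi f) <->
  exists M : R, \forall x \ae mu, f x != 0 -> (q x <= M%:E)%E.
Proof.
rewrite /vLb/= exponent_sup_lty.
have : vL_null (repr (\pi_vLspace f) - f).
  by apply/(quot_eqP vL_null_subspace); rewrite reprK.
move=> h; set g : vLfunType := repr _.
have {}h : \forall x \ae mu, g x = f x.
  by apply: filterS h => x fx; apply/eqP; rewrite -subr_eq0; apply/eqP.
by split=> -[M HM]; exists M; apply: filterS2 h HM => x hx /=; rewrite hx.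
Qed.

Lemma vLb0 : vLb 0.
Proof.
rewrite -(raddf0 (\pi_(quotient_space vL_null_subspace))).
by apply/vLbP; exists 0; apply: nearW => x; rewrite eqxx.
Qed.

Lemma vLb_lin a F G : vLb F -> vLb G -> vLb (a *: F + G).
Proof.
rewrite -[F]reprK -[G]reprK => /vLbP[M FM] /vLbP[N GN].
rewrite -[a *: _](quot_piZ vL_null_subspace) -[_ + _](quot_piD vL_null_subspace).
apply/vLbP; exists (Num.max M N); apply: filterS2 FM GN => x Fx Gx FGx.
have [F0|/Fx FM] := eqVneq ((repr F : vLfunType) x) 0; last first.
  by rewrite (le_trans FM)// lee_fin le_max lexx.
have [G0|/Gx GM] := eqVneq ((repr G : vLfunType) x) 0; last first.
  by rewrite (le_trans GM)// lee_fin le_max lexx orbT.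
move: FGx; rewrite [X in X != _](_ : _ = a *: (repr F : vLfunType) x + (repr G : vLfunType) x)//.
by rewrite F0 G0 scaler0 addr0 eqxx.
Qed.

Definition vLb_subspace : subspace vLspace := Subspace vLb0 vLb_lin.

Definition germ_space : normedModType R :=
  @normed_quotient R vLspace (closure_subspace vLb_subspace) (@closed_closure _ vLb).

End vLspace.

Section dual_exponent.
Context d (T : measurableType d) (R : realType).
Variable p : exponent T R.

Let mp' : measurable_fun setT (fun x => hoelder_conjugate (p x)).
Proof.
have mp := exponent_measurable p.
rewrite (_ : (fun x => _) = (fun x => if p x == +oo then 1 else if p x == 1 then +oo else
   (fine (p x) * (fine (p x) - 1) `^ (-1))%:E)%E); last first.
  apply/funext => x; have := exponent_ge1 p x.
  case: (p x) => [r||]//=; rewrite lee_fin => r1.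
  case: eqVneq => [[->]|r1']; first by rewrite hoelder_conjugate1.
  have rgt1 : 1 < r by rewrite lt_neqAle r1 andbT eq_sym; apply: contra_neq r1' => ->.
  rewrite /hoelder_conjugate/= eqe gt_eqF ?(lt_trans ltr01)//.
  rewrite -EFinB inver subr_eq0 (gt_eqF rgt1) -EFinM powR_inv1// subr_ge0.
  exact: ltW.
have mf : measurable_fun setT (fun x => fine (p x)).
  by apply: (measurableT_comp (fine_measurable _)).
apply: measurable_fun_ifT => //; first exact: measurable_fun_eqe.
apply: measurable_fun_ifT => //; first exact: measurable_fun_eqe.
apply/measurable_EFinP; apply: measurable_funM => //.
apply: (@measurableT_comp _ _ _ _ _ _ (@powR R ^~ (-1))) => //.
exact: measurable_funB.
Qed.

(* With 1 <= p x, hoelder_conjugate (p x) is the unique solution of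
   (p x)^-1 + p'^-1 = 1 in \bar R, see hoelder_conjugateP *)
Definition dual_exponent : exponent T R :=
  @Exponent _ T R (fun x => hoelder_conjugate (p x)) mp'
    (fun x => hoelder_conj_ge1 (exponent_ge1 p x)).

Lemma dual_exponentP x : ((p x)^-1 + (dual_exponent x)^-1 = 1)%E.
Proof.
have p1 := exponent_ge1 p x.
apply: hoelder_conjugate_eq1; first by rewrite (lt_le_trans _ p1)// ltNyr.
by rewrite gt_eqF// (lt_le_trans _ p1).
Qed.

End dual_exponent.

(* Main.v *)
(* Let [I_h f = \int f h] for [h] in [L^{p'}]. By Hoelder's inequality [I_h] is a
   bounded functional on [L^p], and every functional [psi] on the germ space
   pulls back to one on [L^p] vanishing on [L_b]; the isomorphism is the inverse
   of [(h, psi) |-> I_h + psi \o germ].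

   It is bounded below because [I_h] and [I_h + psi \o germ] agree on [L_b], and
   the values of [I_h] on [L_b] control the norm of [h]: test with truncations of
   the extremal function [sgn h * |h| ^ (p' - 1)].

   It is onto because the restriction of a functional [phi] to [L_b] is some
   [I_h]. By sigma-finiteness there is [w > 0] such that [\int (c w) ^ p] is finite
   for every [c], so dominated convergence makes [A |-> phi (w 1_A)] a charge. Its
   Radon-Nikodym derivative divided by [w] is [h]; the identity [phi f = I_h f]
   passes from simple multiples of [w] to functions dominated by a multiple of
   [w], and these are dense in [L_b]. Then [phi - I_h] factors through the germ
   space. *)
Require Import Defs.
From HB Require Import structures.
From mathcomp Require Import all_boot all_order all_algebra.
From mathcomp Require Import all_classical all_reals all_analysis.
From mathcomp Require Import ess_sup_inf measurable_realfun lra ring.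
Import Order.TTheory GRing.Theory Num.Def Num.Theory.
Import numFieldNormedType.Exports.
Set Implicit Arguments.
Unset Strict Implicit.
Unset Printing Implicit Defensive.
Local Open Scope classical_set_scope.
Local Open Scope ring_scope.

(** * Luxemburg norm and Hoelder's inequality *)

Section luxemburg_modular.
Context d (T : measurableType d) (R : realType).
Variables (mu : {measure set T -> \bar R}) (q : exponent T R).
Implicit Types (f g : T -> R) (k l M : R).

Lemma measurable_fine_exponent : measurable_fun [set: T] (fine \o q).
Proof.
by apply: (measurableT_comp (fine_measurable _)) => //; exact: exponent_measurable.
Qed.

Lemma measurable_exponent_powR f : measurable_fun setT f ->
  measurable_fun setT (fun x => `|f x| `^ fine (q x)).
Proof.
move=> mf; apply: measurable_powR2; first exact: measurableT_comp.
exact: measurable_fine_exponent.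
Qed.

Lemma luxemburg_le f l : 0 < l -> (modular mu q (fun x => f x / l)%R <= 1)%E ->
  luxemburg mu q f <= l.
Proof. by move=> l0 fl; apply: ge_inf => //; exists 0 => k [/ltW]. Qed.

(** The strict inequality yields an admissible [k < l], and [f / l] is [f / k] scaled by
    [k / l <= 1]. Whether the infimum itself is attained is thus left aside. *)
Lemma modular_luxemburg_lt f l : f \in vLfun mu q -> luxemburg mu q f < l ->
  (modular mu q (fun x => f x / l)%R <= 1)%E.
Proof.
move=> /vLfunP[mf fl] /inf_lt-/(_ fl)[k [k0 mk] kl].
have l0 : 0 < l by exact: lt_trans kl.
rewrite (_ : (fun x => _) = (fun x => (k / l) * (f x / k))); last first.
  by apply/funext => x; field; rewrite !gt_eqF.
rewrite (le_trans (modular_scale _ _ _ _))//.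
- exact: measurable_funM.
- by rewrite divr_ge0 ?(ltW k0) ?(ltW l0)//= ler_pdivrMr// mul1r ltW.
- rewrite -[leRHS]mul1e lee_pmul ?modular_ge0// lee_fin.
    by rewrite divr_ge0 ?(ltW k0) ?(ltW l0).
  by rewrite ler_pdivrMr// mul1r ltW.
Qed.

(** Convexity gives [modular (f / M) <= modular f / M] for [M >= 1]. *)
Lemma luxemburg_le_modular f M : measurable_fun setT f -> 1 <= M ->
  (modular mu q f <= M%:E)%E -> luxemburg mu q f <= M.
Proof.
move=> mf M1 fM; have M0 : 0 < M by exact: lt_le_trans M1.
apply: luxemburg_le => //.
rewrite (_ : (fun x => _) = (fun x => M^-1 * f x)); last first.
  by apply/funext => x; rewrite mulrC.
rewrite (le_trans (modular_scale _ _ _ _))//.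
  by rewrite invr_ge0 (ltW M0)/= invf_le1.
rewrite (@le_trans _ _ (M^-1%:E * M%:E)%E)//.
  by rewrite lee_pmul ?modular_ge0 ?lee_fin ?invr_ge0 ?(ltW M0).
by rewrite -EFinM mulVf ?gt_eqF.
Qed.

Lemma vLfun_modular f : measurable_fun setT f -> (modular mu q f < +oo)%E ->
  f \in vLfun mu q.
Proof.
move=> mf fy; apply/asboolP; split=> //; exists 1 => //.
by under eq_fun do rewrite divr1.
Qed.

Lemma integral_exponent_fin (F : T -> R) :
  (\int[mu]_(x in [set x | q x != +oo%E]) (F x)%:E =
   \int[mu]_x (if q x == +oo%E then 0 else F x)%:E)%E.
Proof.
rewrite integral_mkcond; apply: eq_integral => x _; rewrite patchE.
case: ifPn => [/set_mem/= /negbTE -> //|/negP xD].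
by case: eqP => // /eqP qx; case: xD; rewrite mem_set.
Qed.

Lemma modular_fin_ae f : mu [set x | q x = +oo%E] = 0%E -> measurable_fun setT f ->
  modular mu q f =
  (\int[mu]_(x in [set x | q x != +oo%E]) (`|f x| `^ fine (q x))%:E)%E.
Proof.
move=> q0 mf; rewrite /modular [X in (_ + X)%E](_ : _ = 0%E) ?adde0//.
have mr : measurable_fun setT (f \_ [set x | q x = +oo%E]).
  apply/(measurable_restrictT _ _).1; first exact: measurable_exponent_oo.
  exact: measurable_funTS.
rewrite -(@Lnorm0 _ _ R mu +oo%E) //.
rewrite unlock; case: ifPn => // _; apply: eq_ess_sup.
exists [set x | q x = +oo%E]; split=> //; first exact: measurable_exponent_oo.
move=> x /= ; apply: contra_notP => qx; rewrite patchE memNset//=.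
Qed.

End luxemburg_modular.

Section hoelder.
Context d (T : measurableType d) (R : realType).
Variables (mu : {measure set T -> \bar R}) (p : exponent T R).
Hypothesis p_fin : mu [set x | p x = +oo%E] = 0%E.
Let p' := dual_exponent p.

Lemma dual_exponent_eqy x : p' x = +oo%E -> p x = 1%E.
Proof. exact: hoelder_conjugate_eqy. Qed.

Lemma dual_exponent1 x : p x = 1%E -> p' x = +oo%E.
Proof. by move=> px; rewrite /p' /= px hoelder_conjugate1. Qed.

Lemma fine_dual_exponent x : p x != +oo%E -> p' x != +oo%E ->
  [/\ 1 < fine (p x), 1 <= fine (p' x) &
  (fine (p x))^-1 + (fine (p' x))^-1 = 1].
Proof.
move=> px p'x.
have r1 := fineq_ge1 px; have s1 := fineq_ge1 p'x.
have p1 : p x != 1%E by apply: contra p'x => /eqP/dual_exponent1 ->.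
have := dual_exponentP p x; rewrite -/p'.
move: r1 s1 px p'x p1; have := exponent_ge1 p x; have := exponent_ge1 p' x.
case: (p x) => [r||]//; case: (p' x) => [s||]// s1 r1 /= r1' s1' _ _ rn1.
rewrite !inver !gt_eqF ?(lt_le_trans ltr01)// -EFinD => -[].
split=> //; rewrite lt_neqAle r1' andbT eq_sym.
by apply: contra rn1 => /eqP ->.
Qed.

(** The weights [1 / p] and [1 / p'] of Young's inequality are bounded by 1, which costs the
    constant 2 in Hoelder's inequality. *)
Lemma young_exponent x (a b : R) : 0 <= a -> 0 <= b ->
  p x != +oo%E -> p' x != +oo%E ->
  a * b <= a `^ fine (p x) + b `^ fine (p' x).
Proof.
move=> a0 b0 px p'x; have [r1 s1 rs] := fine_dual_exponent px p'x.
have r0 : 0 < fine (p x) by exact: lt_trans r1.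
have s0 : 0 < fine (p' x) by exact: lt_le_trans s1.
rewrite (le_trans (conjugate_powR a0 b0 r0 s0 rs))// lerD//.
  by rewrite ler_pdivrMr// ler_peMr ?powR_ge0// ltW.
by rewrite ler_pdivrMr// ler_peMr ?powR_ge0.
Qed.

Lemma modular_ae_le1 (f : T -> R) : measurable_fun setT f -> (modular mu p' f <= 1)%E ->
  \forall x \ae mu, p' x = +oo%E -> `|f x| <= 1.
Proof.
(* For the zero measure the norm at [+oo] is 0 and bounds nothing, but then every property holds
   almost everywhere. *)
move=> mf; have [mu0|mu0] := ltP 0%E (mu [set: T]); last first.
  move=> _; exists setT; split=> //.
  by apply/eqP; rewrite eq_le mu0 measure_ge0.
move=> f1.
have : ('N[mu]_+oo[EFin \o (f \_ [set x | p' x = +oo%E])] <= 1)%E.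
  apply: le_trans f1; rewrite leeDr//.
  by apply: integral_ge0 => x _; rewrite lee_fin powR_ge0.
rewrite unlock mu0 => /ess_supP; apply: filterS => x /=.
by move=> + px; rewrite patchE mem_set.
Qed.

Lemma hoelder_modular (f h : T -> R) : measurable_fun setT f -> measurable_fun setT h ->
  (modular mu p f <= 1)%E -> (modular mu p' h <= 1)%E ->
  (\int[mu]_x `|f x * h x|%:E <= 2%:E)%E.
Proof.
move=> mf mh f1 h1.
have mDp := measurable_exponent_fin p; have mDp' := measurable_exponent_fin p'.
pose F x := `|f x| `^ fine (p x); pose H x := `|h x| `^ fine (p' x).
have mF : measurable_fun setT F by exact: measurable_exponent_powR.
have mH : measurable_fun setT H by exact: measurable_exponent_powR.
have F0 x : 0 <= F x by exact: powR_ge0.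
have H0 x : 0 <= H x by exact: powR_ge0.
pose F' x := if p x == +oo%E then 0 else F x.
pose H' x := if p' x == +oo%E then 0 else H x.
have F'0 x : 0 <= F' x by rewrite /F'; case: ifP.
have H'0 x : 0 <= H' x by rewrite /H'; case: ifP.
have mF' : measurable_fun setT F'.
  by apply: measurable_fun_ifT => //; apply: measurable_fun_eqe => //; exact: exponent_measurable.
have mH' : measurable_fun setT H'.
  by apply: measurable_fun_ifT => //; apply: measurable_fun_eqe => //; exact: exponent_measurable.
apply: (@le_trans _ _ (\int[mu]_x ((F' x)%:E + (H' x)%:E))%E).
  apply: ae_ge0_le_integral => //.
  - by apply/measurable_EFinP; apply: measurableT_comp => //; exact: measurable_funM.
  - by move=> x _; rewrite adde_ge0 ?lee_fin.
  - by apply: emeasurable_funD; exact/measurable_EFinP.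
  have pE : \forall x \ae mu, p x != +oo%E.
    exists [set x | p x = +oo%E]; split=> //; first exact: measurable_exponent_oo.
    by move=> x /= /negP; rewrite negbK => /eqP.
  apply: filterS2 pE (modular_ae_le1 mh h1) => x px hx _.
  rewrite -EFinD lee_fin normrM /F' /H' (negbTE px).
  (* Where [p' = +oo] one has [p = 1], and [|h| <= 1] takes the place of Young's inequality. *)
  have [p'x|p'x] := eqVneq (p' x) +oo%E.
    rewrite addr0 /F (dual_exponent_eqy p'x)/= powRr1//.
    by rewrite ler_piMr// hx.
  exact: young_exponent.
rewrite ge0_integralD//; first last.
- exact/measurable_EFinP.
- by move=> x _; rewrite lee_fin.
- exact/measurable_EFinP.
- by move=> x _; rewrite lee_fin.
rewrite -[2]/(1 + 1) EFinD leeD//.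
  by rewrite -(integral_exponent_fin mu p) -modular_fin_ae.
apply: le_trans h1; rewrite /modular -/p'.
by rewrite integral_exponent_fin leeDl ?Lnorm_ge0.
Qed.

Lemma hoelder_luxemburg (f h : T -> R) : f \in vLfun mu p -> h \in vLfun mu p' ->
  (\int[mu]_x `|f x * h x|%:E <= (2 * luxemburg mu p f * luxemburg mu p' h)%:E)%E.
Proof.
move=> fV hV; have [mf _] := (vLfunP _ _ _).1 fV; have [mh _] := (vLfunP _ _ _).1 hV.
have a0 := luxemburg_ge0 fV; have b0 := luxemburg_ge0 hV.
set a := luxemburg mu p f in a0 *; set b := luxemburg mu p' h in b0 *.
(* Dividing by [a + e] and [b + e] makes both modulars at most 1 and also covers norms equal to
   0. *)
have key (e : R) : 0 < e ->
    (\int[mu]_x `|f x * h x|%:E <= (2 * (a + e) * (b + e))%:E)%E.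
  move=> e0; have ae0 : 0 < a + e by exact: ltr_wpDl.
  have be0 : 0 < b + e by exact: ltr_wpDl.
  have := hoelder_modular _ _
    (modular_luxemburg_lt fV (_ : _ < a + e)) (modular_luxemburg_lt hV (_ : _ < b + e)).
  move=> /(_ _ _ _ _)/[!ltrDl].
  move=> /(_ (measurable_funM mf (measurable_cst _))).
  move=> /(_ (measurable_funM mh (measurable_cst _)) e0 e0).
  under eq_integral do rewrite mulrACA -invfM normrM (@ger0_norm _ _^-1)
    ?invr_ge0 ?mulr_ge0 ?(ltW ae0) ?(ltW be0)// EFinM.
  rewrite ge0_integralZr//.
  - by rewrite -lee_pdivlMr ?invr_gt0 ?mulr_gt0// invrK -mulrA EFinM.
  - by apply/measurable_EFinP; apply: measurableT_comp => //; exact: measurable_funM.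
  - by rewrite lee_fin invr_ge0 mulr_ge0 ?ltW.
have Ifin : (\int[mu]_x `|f x * h x|%:E)%E \is a fin_num.
  rewrite ge0_fin_numE ?integral_ge0// (le_lt_trans (key 1 ltr01))//.
  exact: ltry.
rewrite -(fineK Ifin) lee_fin; set I := fine _.
have {}key e : 0 < e -> I <= 2 * (a + e) * (b + e).
  by move=> /key; rewrite -(fineK Ifin) lee_fin.
apply/ler_addgt0Pr => e e0.
(* As [t <= 1], the product [2 (a + t) (b + t)] exceeds [2 a b] by at most
   [2 t (a + b + 1) <= e]. *)
pose t := Num.min 1 (e / (2 * (a + b + 1))).
have ab : 0 < 2 * (a + b + 1) by rewrite mulr_gt0// ltr_wpDl// addr_ge0.
have t0 : 0 < t by rewrite lt_min ltr01 divr_gt0.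
have t1 : t <= 1 by rewrite ge_min lexx.
have te : t * (2 * (a + b + 1)) <= e by rewrite -ler_pdivlMr// ge_min lexx orbT.
rewrite (le_trans (key _ t0))//; nra.
Qed.

Lemma vLfun_integrableM (f h : T -> R) : f \in vLfun mu p -> h \in vLfun mu p' ->
  mu.-integrable setT (EFin \o (fun x => f x * h x)).
Proof.
move=> fV hV; have [mf _] := (vLfunP _ _ _).1 fV; have [mh _] := (vLfunP _ _ _).1 hV.
apply/integrableP; split; first by apply/measurable_EFinP; exact: measurable_funM.
by rewrite (le_lt_trans (hoelder_luxemburg fV hV))// ltry.
Qed.

Lemma hoelder_Rintegral (f h : T -> R) : f \in vLfun mu p -> h \in vLfun mu p' ->
  `|\int[mu]_x (f x * h x)| <= 2 * luxemburg mu p f * luxemburg mu p' h.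
Proof.
move=> fV hV; have fh := vLfun_integrableM fV hV.
rewrite (le_trans (le_normr_Rintegral _ fh))// -lee_fin fineK.
  exact: hoelder_luxemburg.
rewrite ge0_fin_numE ?integral_ge0// (le_lt_trans (hoelder_luxemburg fV hV))//.
exact: ltry.
Qed.

End hoelder.

(** * Dominated convergence in norm *)

Section sigma_finite_weight.
Context d (T : measurableType d) (R : realType).
Variable mu : {sigma_finite_measure set T -> \bar R}.

(** Take a weighted sum of the indicators of a countable cover by sets of finite measure. Dividing
    by [1 + mu (F n)] bounds the n-th integral by [2 ^ -(n + 1)], and covering makes the sum
    positive everywhere. *)
Lemma exists_integrable_gt0 : exists g : T -> R,
  [/\ measurable_fun setT g, forall x, 0 < g x <= 1 &
    mu.-integrable setT (EFin \o g)].
Proof.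
have [F TF mF] := sigma_finiteT mu.
pose c n : R := (2 ^ n.+1)%:R^-1 / (1 + fine (mu (F n))).
have muF0 n : 0 <= fine (mu (F n)) by exact: fine_ge0.
have muF1 n : 0 < 1 + fine (mu (F n)) by rewrite ltr_pwDl.
have c0 n : 0 < c n by rewrite divr_gt0// invr_gt0 ltr0n expn_gt0.
pose G x : \bar R := (\sum_(n <oo) (c n)%:E * (\1_(F n) x)%:E)%E.
have cF0 n x : (0 <= (c n)%:E * (\1_(F n) x)%:E)%E.
  by rewrite -EFinM lee_fin mulr_ge0// ltW.
have mcF n : measurable_fun setT (fun x => (c n)%:E * (\1_(F n) x)%:E)%E.
  apply: measurable_funeM; apply/measurable_EFinP; apply: measurable_indic.
  exact: (mF n).1.
have mG : measurable_fun setT G.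
  exact: (@ge0_emeasurable_sum _ _ _ setT (fun n x => (c n)%:E * (\1_(F n) x)%:E)%E xpredT).
have G0 x : (0 < G x)%E.
  have [n _ Fnx] : (\bigcup_n F n) x by rewrite -TF.
  apply: (@lt_le_trans _ _ ((c n)%:E * (\1_(F n) x)%:E)%E).
    by rewrite -EFinM lte_fin indicE mem_set// mulr1.
  rewrite /G (@nneseriesD1 _ _ n)// leeDl//.
  by apply: nneseries_ge0 => k _ _; exact: cF0.
have IG : (\int[mu]_x G x <= 1)%E.
  rewrite /G integral_nneseries//.
  apply: le_trans (epsilon_trick0 xpredT (@ler01 R)).
  apply: lee_nneseries => [n _ _|n _].
    by apply: integral_ge0 => x _; exact: cF0.
  rewrite ge0_integralZl//; last 2 first.
  - by apply/measurable_EFinP; apply: measurable_indic; exact: (mF n).1.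
  - by rewrite lee_fin ltW.
  rewrite integral_indic//; last exact: (mF n).1.
  have fF : mu (F n) = (fine (mu (F n)))%:E.
    by rewrite fineK// ge0_fin_numE// (mF n).2.
  rewrite setIT [X in (_ * X)%E]fF -EFinM lee_fin /c mul1r -mulrA ler_piMr ?invr_ge0 ?ler0n//.
  by rewrite mulrC ler_pdivrMr// mul1r lerDr.
(* Capping at 1 gives real values and the upper bound without estimating the series pointwise. *)
have Gfin x : mine (G x) 1%E \is a fin_num.
  rewrite ge0_fin_numE; last by rewrite le_min (ltW (G0 x)) lee_fin ler01.
  by rewrite gt_min ltry orbT.
have mg : measurable_fun setT (fun x => mine (G x) 1%E).
  exact: measurable_mine.
exists (fun x => fine (mine (G x) 1%E)); split.
- exact: (measurableT_comp (fine_measurable _)).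
- move=> x; rewrite -lte_fin -lee_fin fineK// lt_min G0/= lte_fin ltr01/=.
  by rewrite ge_min lexx orbT.
- apply/integrableP; split.
    by apply/measurable_EFinP; exact: (measurableT_comp (fine_measurable _)).
  rewrite (@le_lt_trans _ _ (\int[mu]_x G x)%E)//; last first.
    by rewrite (le_lt_trans IG)// ltry.
  apply: ge0_le_integral => //.
  - apply: measurableT_comp => //; apply/measurable_EFinP.
    exact: (measurableT_comp (fine_measurable _)).
  - move=> x _; rewrite [X in `|X|%E](_ : _ = mine (G x) 1%E); last exact: fineK.
    rewrite gee0_abs; first by rewrite ge_min lexx.
    by rewrite le_min (ltW (G0 x)) lee_fin ler01.
Qed.

End sigma_finite_weight.

Section order_continuity.
Context d (T : measurableType d) (R : realType).
Variables (mu : {measure set T -> \bar R}) (p : exponent T R).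
Hypothesis p_fin : mu [set x | p x = +oo%E] = 0%E.
Implicit Types (f g : T -> R) (c : R).

(** The extension by 0 over the null set [p = +oo] makes the modular a single integral over the
    whole space, as the convergence theorems require. *)
Definition modular_density f x : R :=
  if p x == +oo%E then 0 else `|f x| `^ fine (p x).

Lemma modular_density_ge0 f x : 0 <= modular_density f x.
Proof. by rewrite /modular_density; case: ifP => // _; exact: powR_ge0. Qed.

Lemma measurable_modular_density f : measurable_fun setT f ->
  measurable_fun setT (modular_density f).
Proof.
move=> mf; apply: measurable_fun_ifT => //; last exact: measurable_exponent_powR.
by apply: measurable_fun_eqe => //; exact: exponent_measurable.
Qed.

Lemma modularE f : measurable_fun setT f ->
  modular mu p f = (\int[mu]_x (modular_density f x)%:E)%E.
Proof. by move=> mf; rewrite modular_fin_ae// integral_exponent_fin. Qed.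

Lemma exponent_fin_ae : \forall x \ae mu, p x != +oo%E.
Proof.
exists [set x | p x = +oo%E]; split=> //; first exact: measurable_exponent_oo.
by move=> x /= /negP; rewrite negbK => /eqP.
Qed.

Lemma ler_modular_density f g x : `|f x| <= `|g x| ->
  modular_density f x <= modular_density g x.
Proof.
move=> fg; rewrite /modular_density; case: ifPn => // px.
by rewrite ge0_ler_powR ?nnegrE// (le_trans ler01)// fineq_ge1.
Qed.

Lemma le_modular f g : measurable_fun setT f -> measurable_fun setT g ->
  (forall x, `|f x| <= `|g x|) -> (modular mu p f <= modular mu p g)%E.
Proof.
move=> mf mg fg; rewrite (modularE mf) (modularE mg).
apply: ge0_le_integral; first exact: measurableT.
- by move=> x _; rewrite lee_fin modular_density_ge0.
- by apply/measurable_EFinP; exact: measurable_modular_density.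
- by apply/measurable_EFinP; exact: measurable_modular_density.
- by move=> x _; rewrite lee_fin ler_modular_density.
Qed.

(* Unlike membership in [vLfun], which asks for one [c > 0], this makes dominated
   convergence imply convergence in norm. *)
Definition finite_element : set (T -> R) := [set f | measurable_fun setT f /\
  forall c, (modular mu p (fun x => c * f x)%R < +oo)%E].

Lemma finite_element_vLfun f : finite_element f -> f \in vLfun mu p.
Proof.
move=> [mf fy]; apply: vLfun_modular => //.
by have := fy 1; under eq_fun do rewrite mul1r.
Qed.

Lemma finite_elementZ f c : finite_element f -> finite_element (fun x => c * f x).
Proof.
move=> [mf fy]; split; first exact: measurable_funM.
by move=> k; under eq_fun do rewrite mulrA.
Qed.

Lemma le_finite_element f g : measurable_fun setT f -> finite_element g ->
  (forall x, `|f x| <= `|g x|) -> finite_element f.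
Proof.
move=> mf [mg gy] fg; split=> // c; apply: le_lt_trans (gy c).
apply: le_modular; try exact: measurable_funM.
by move=> x; rewrite !normrM ler_wpM2l.
Qed.

Lemma le_vLfun f g : measurable_fun setT f -> g \in vLfun mu p ->
  (forall x, `|f x| <= `|g x|) -> f \in vLfun mu p.
Proof.
move=> mf /vLfunP[mg [l [l0 gl]]] fg; apply/vLfunP; split=> //.
exists l; split=> //; apply: le_trans gl; apply: le_modular; try exact: measurable_funM.
by move=> x; rewrite !normrM ler_wpM2r.
Qed.

(** The density of [f / e] is integrable because [f] is a finite element, and it dominates those of
    [g n / e]. Hence the modulars of [g n / e] tend to 0 and are eventually at most 1. *)
Lemma luxemburg_dominated_cvg0 f (g : (T -> R)^nat) : finite_element f ->
  (forall n, measurable_fun setT (g n)) -> (forall n x, `|g n x| <= `|f x|) ->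
  (\forall x \ae mu, g ^~ x @ \oo --> 0) ->
  forall e, 0 < e -> \forall n \near \oo, luxemburg mu p (g n) <= e.
Proof.
move=> [mf fy] mg gf g0 e e0.
have mD h : measurable_fun setT h ->
    measurable_fun setT (EFin \o modular_density (fun x => e^-1 * h x)).
  move=> mh; apply/measurable_EFinP; apply: measurable_modular_density.
  exact: measurable_funM.
have [] := @dominated_convergence _ _ _ mu setT measurableT
  (fun n => EFin \o modular_density (fun x => e^-1 * g n x)) (cst 0%E)
  (EFin \o modular_density (fun x => e^-1 * f x)).
- by move=> n; exact: mD.
- exact: measurable_cst.
- apply: filterS g0 => x gx _; rewrite /modular_density /=.
  have [px|px] := eqVneq (p x) +oo%E; first exact: cvg_cst.
  apply: cvg_EFin; first by apply: nearW.
  have gex : (fun n => `|e^-1 * g n x|) @ \oo --> (0 : R).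
    rewrite -(normr0 R); apply: cvg_norm; rewrite -(mulr0 e^-1).
    exact: cvgMl_tmp.
  (* Once the base is at most 1, its power with exponent at least 1 lies below the base itself. *)
  apply: (@squeeze_cvgr _ _ _ _ (cst 0) (fun n => `|e^-1 * g n x|)) => //; last exact: cvg_cst.
  have : \forall n \near \oo, `|e^-1 * g n x| <= 1.
    move/cvgrPdist_le : gex => /(_ _ ltr01).
    by apply: filterS => n; rewrite sub0r normrN normr_id.
  apply: filterS => n n1 /=; rewrite powR_ge0/=.
  have [->|nz] := eqVneq `|e^-1 * g n x| 0.
    by rewrite powR0// gt_eqF// (lt_le_trans ltr01)// fineq_ge1.
  by rewrite ge1r_powR// ?fineq_ge1// n1 andbT lt_neqAle eq_sym nz /=.
- apply/integrableP; split; first exact: mD.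
  rewrite (eq_integral (EFin \o modular_density (fun x => e^-1 * f x))); last first.
    by move=> x _ /=; rewrite ger0_norm// modular_density_ge0.
  by rewrite -modularE//; exact: measurable_funM.
- apply: aeW => x n _; rewrite /= lee_fin ger0_norm ?modular_density_ge0//.
  by apply: ler_modular_density; rewrite !normrM ler_wpM2l.
move=> _ _; rewrite integral_cst// mul0e => /fine_cvgP[+ /cvgrPdist_le/(_ _ ltr01)].
apply: filterS2 => n nfin; rewrite sub0r normrN => n1.
apply: luxemburg_le => //; rewrite modularE; last exact: measurable_funM.
rewrite (eq_integral (EFin \o modular_density (fun x => e^-1 * g n x))); last first.
  by move=> x _; rewrite /modular_density/= mulrC.
rewrite /= in nfin n1.
by rewrite -(fineK nfin) lee_fin (le_trans (ler_norm _)).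
Qed.

Lemma bounded_exponent_finite_element f (M : R) : f \in vLfun mu p ->
  (\forall x \ae mu, f x != 0 -> (p x <= M%:E)%E) -> finite_element f.
Proof.
move=> /vLfunP[mf [l [l0 fl]]] fM; split=> // c.
(* Write [c f = (c l) (f / l)]: almost everywhere on the support of [f], [p <= M] and [K >= 1] give
   [|c l| ^ p <= K ^ M]. *)
pose K := Num.max 1 `|c * l|.
have K1 : 1 <= K by rewrite le_max lexx.
rewrite modularE; last exact: measurable_funM.
rewrite (@le_lt_trans _ _ (\int[mu]_x ((K `^ M)%:E *
    (modular_density (fun x => f x / l) x)%:E))%E)//.
  apply: ae_ge0_le_integral => //.
  - by move=> x _; rewrite lee_fin modular_density_ge0.
  - by apply/measurable_EFinP; apply: measurable_modular_density; exact: measurable_funM.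
  - by move=> x _; rewrite -EFinM lee_fin mulr_ge0 ?powR_ge0 ?modular_density_ge0.
  - apply: measurable_funeM.
    by apply/measurable_EFinP; apply: measurable_modular_density; exact: measurable_funM.
  apply: filterS fM => x fxM _; rewrite -EFinM lee_fin /modular_density.
  case: ifPn => px; first by rewrite mulr0.
  have r1 := fineq_ge1 px; have r0 : fine (p x) != 0 by rewrite gt_eqF// (lt_le_trans ltr01).
  have [->|fx0] := eqVneq (f x) 0; first by rewrite mulr0 mul0r normr0 powR0 ?mulr0.
  have -> : c * f x = (c * l) * (f x / l) by field; rewrite gt_eqF.
  rewrite normrM powRM// ler_wpM2r ?powR_ge0//.
  apply: (@le_trans _ _ (K `^ fine (p x))).
    by rewrite ge0_ler_powR ?nnegrE// ?(le_trans ler01)// le_max lexx orbT.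
  rewrite ler_powR// -lee_fin fineK ?fxM//.
  by rewrite fin_numE px andbT gt_eqF// (lt_le_trans _ (exponent_ge1 p x))// ltNyr.
rewrite ge0_integralZl//.
- rewrite -modularE; last exact: measurable_funM.
  rewrite lte_mul_pinfty ?lee_fin ?powR_ge0//.
  by rewrite (le_lt_trans fl)// ltry.
- by apply/measurable_EFinP; apply: measurable_modular_density; exact: measurable_funM.
- by move=> x _; rewrite lee_fin modular_density_ge0.
- by rewrite lee_fin powR_ge0.
Qed.

End order_continuity.

Section finite_weight.
Context d (T : measurableType d) (R : realType).
Variables (mu : {sigma_finite_measure set T -> \bar R}) (p : exponent T R).
Hypothesis p_fin : mu [set x | p x = +oo%E] = 0%E.

(* If [0 < g <= 1] is integrable, then [w = g / p] works, because
   [(c * g / p) ^ p <= g * (c / p) ^ p <= g * exp c] *)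
Lemma exists_finite_weight : exists2 w : T -> R,
  finite_element mu p w & forall x, 0 < w x.
Proof.
have [g [mg g01 ig]] := exists_integrable_gt0 mu.
(* Since [fine +oo = 0], the maximum with 1 keeps the divisor positive on the null set [p = +oo]. *)
pose r x := Num.max 1 (fine (p x)).
have r1 x : 1 <= r x by rewrite le_max lexx.
have r0 x : 0 < r x by rewrite (lt_le_trans ltr01).
pose w x := g x * (r x)^-1.
have mr : measurable_fun setT r.
  by apply: measurable_maxr => //; exact: measurable_fine_exponent.
have mw : measurable_fun setT w.
  apply: measurable_funM => //.
  rewrite (_ : (fun x => _) = (fun x => r x `^ (-1))).
    exact: (measurableT_comp (measurable_powR _)).
  by apply/funext => x; rewrite powR_inv1// ltW.
have w0 x : 0 < w x by have /andP[g0 _] := g01 x; rewrite mulr_gt0 ?invr_gt0.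
exists w => //; split=> // c.
rewrite modularE//; last exact: measurable_funM.
rewrite (@le_lt_trans _ _ (\int[mu]_x ((expR `|c|)%:E * (EFin \o g) x))%E)//.
  apply: ge0_le_integral => //.
  - by move=> x _; rewrite lee_fin modular_density_ge0.
  - by apply/measurable_EFinP; apply: measurable_modular_density; exact: measurable_funM.
  - by apply: measurable_funeM; exact/measurable_EFinP.
  - move=> x _; rewrite -EFinM lee_fin /modular_density; have /andP[g0 g1] := g01 x.
    case: ifPn => [_|px]; first by rewrite mulr_ge0 ?expR_ge0// ltW.
    have p1 := fineq_ge1 px.
    rewrite normrM (gtr0_norm (w0 x)) /w mulrCA powRM ?(ltW g0)//; last first.
      by rewrite mulr_ge0// invr_ge0 ltW.
    rewrite mulrC ler_pM ?powR_ge0//; last by rewrite ge1r_powR// g0.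
    have -> : r x = fine (p x) by apply/max_idPr.
    have pos : 0 < fine (p x) by rewrite (lt_le_trans ltr01).
    have [->|c0] := eqVneq c 0; first by rewrite normr0 mul0r powR0 ?expR_ge0// gt_eqF.
    have cp : 0 < `|c| / fine (p x) by rewrite divr_gt0 ?normr_gt0.
    (* With [t = |c| / p], the bound [ln t <= t - 1 <= t] gives [t ^ p <= exp (p t) = exp |c|]. *)
    rewrite /powR gt_eqF// ler_expR.
    rewrite (@le_trans _ _ (fine (p x) * (`|c| / fine (p x))))//; last first.
      by rewrite mulrCA divff ?mulr1// gt_eqF.
    rewrite ler_wpM2l ?(ltW pos)//.
    have := @le_ln1Dx _ (`|c| / fine (p x) - 1).
    rewrite subrKC => /(_ _)/le_trans; apply; last by rewrite gerBl.
    by rewrite ltrBrDl subrr.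
rewrite integralZl//.
by rewrite lte_mul_pinfty ?lee_fin ?expR_ge0//; exact: integrable_lty.
Qed.

End finite_weight.

(** * Norm of a density *)

Section test_functions.
Context d (T : measurableType d) (R : realType).
Variables (mu : {measure set T -> \bar R}) (p : exponent T R).
Hypothesis p_fin : mu [set x | p x = +oo%E] = 0%E.
Variable w : T -> R.
Hypotheses (w_fin : finite_element mu p w) (w_gt0 : forall x, 0 < w x).
Let p' := dual_exponent p.

(** Multiples of [w] bound these functions, so Radon-Nikodym reaches them, and their bounded
    exponent puts them in [L_b]. A single [m] for both bounds suits truncation at level [n]. *)
Definition test_function : set (T -> R) := [set f : T -> R | measurable_fun setT f /\
  exists m : nat, forall x, `|f x| <= m%:R * w x /\
    (f x != 0 -> (p x <= m%:R%:E)%E)].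

Lemma test_function_finite_element f : test_function f -> finite_element mu p f.
Proof.
move=> [mf [m fm]]; apply: le_finite_element (finite_elementZ m%:R w_fin) _ => // x.
have [fw _] := fm x; apply: le_trans fw _.
by rewrite [leRHS]ger0_norm// mulr_ge0// ltW.
Qed.

(** Restrict [f] to the set where [|f| <= n w] and [p <= n]. These sets exhaust [p < +oo] because
    [w > 0], and dominated convergence applies. *)
Lemma test_function_dense f e : finite_element mu p f -> 0 < e ->
  exists2 g, test_function g & luxemburg mu p (fun x => f x - g x) <= e.
Proof.
move=> ff e0; have [mf _] := ff; have [mw _] := w_fin.
pose B n x := (`|f x| <= n%:R * w x) && (p x <= n%:R%:E)%E.
have mB n : measurable_fun setT (B n).
  apply: measurable_and.
    by apply: measurable_fun_ler; [exact: measurableT_comp|exact: measurable_funM].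
  by apply: measurable_fun_lee => //; exact: exponent_measurable.
pose g n x := if B n x then f x else 0.
have mg n : measurable_fun setT (g n) by exact: measurable_fun_ifT.
have tg n : test_function (g n).
  split=> //; exists n => x; rewrite /g; case: ifPn => [/andP[fw pn]//|_].
  by rewrite normr0 eqxx mulr_ge0// ltW.
have := @luxemburg_dominated_cvg0 _ _ _ mu p p_fin f (fun n x => f x - g n x) ff.
have cg : \forall x \ae mu, f x - g n x @[n --> \oo] --> 0.
  apply: filterS (exponent_fin_ae p_fin) => x px.
  apply: cvg_near_cst; near=> n.
  rewrite /g ifT ?subrr//; apply/andP; split.
    rewrite -ler_pdivrMr//; near: n; exact: nbhs_infty_ger.
  have pf : p x \is a fin_num.
    by rewrite fin_numE px andbT gt_eqF// (lt_le_trans _ (exponent_ge1 p x))// ltNyr.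
  rewrite -(fineK pf) lee_fin; near: n; exact: nbhs_infty_ger.
move=> /(_ _ _ cg e e0)[].
- by move=> n; exact: measurable_funB.
- by move=> n x; rewrite /g; case: ifP => _; rewrite ?subrr ?normr0 ?subr0.
by move=> n _ /(_ n (leqnn n)); exists (g n).
Unshelve. all: by end_near. Qed.

Section dual_norm_bound.
Variables (h : T -> R) (C : R).
Hypotheses (mh : measurable_fun setT h) (C0 : 0 < C).
Hypothesis hC : forall f, test_function f ->
  mu.-integrable setT (EFin \o (fun x => f x * h x)) /\
  \int[mu]_x (f x * h x) <= C * luxemburg mu p f.

(* With [M = modular f], the hypotheses give [2 C M <= \int f h <= C max(1, M)]. *)
Lemma extremal_modular_le f : test_function f ->
  (forall x, 2 * C * modular_density p f x <= f x * h x) ->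
  (modular mu p f <= (2^-1)%:E)%E.
Proof.
move=> tf fh; have [mf fy] := test_function_finite_element tf.
have [ifh Ifh] := hC tf.
have Mfin : modular mu p f \is a fin_num.
  rewrite ge0_fin_numE ?modular_ge0//.
  by have := fy 1; under eq_fun do rewrite mul1r.
have ME : (modular mu p f <= (Num.max 1 (fine (modular mu p f)))%:E)%E.
  by rewrite -{1}(fineK Mfin) lee_fin le_max lexx orbT.
set M := fine (modular mu p f) in ME *.
have fM : luxemburg mu p f <= Num.max 1 M.
  by apply: luxemburg_le_modular => //; rewrite le_max lexx.
have M2 : 2 * C * M <= \int[mu]_x (f x * h x).
  rewrite -lee_fin EFinM fineK// modularE// -ge0_integralZl//; last 3 first.
  - by apply/measurable_EFinP; exact: measurable_modular_density.
  - by move=> x _; rewrite lee_fin modular_density_ge0.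
  - by rewrite lee_fin mulr_ge0// ltW.
  rewrite fineK; last exact: integrable_fin_num.
  apply: ge0_le_integral; first exact: measurableT.
  - move=> x _; rewrite -EFinM lee_fin mulr_ge0 ?modular_density_ge0//.
    by rewrite mulr_ge0// ltW.
  - by apply: measurable_funeM; apply/measurable_EFinP; exact: measurable_modular_density.
  - by apply/measurable_EFinP; exact: measurable_funM.
  - by move=> x _; rewrite -EFinM lee_fin.
(* For [M > 1] this would read [2 M <= M]; hence [M <= 1] and then [2 M <= 1]. *)
have {}M2 : 2 * M <= Num.max 1 M.
  rewrite -(ler_pM2l C0) mulrCA mulrA (le_trans M2)// (le_trans Ifh)//.
  by rewrite ler_pM2l.
rewrite -(fineK Mfin) lee_fin -/M.
by have := M2; rewrite maxEle; case: ifPn => M1 M2'; lra.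
Qed.

(** With this scaling the pointwise hypothesis of [extremal_modular_le] is an equality for the
    extremal function. *)
Let u x := `|h x| / (2 * C).
Let C20 : 0 < 2 * C. Proof. by rewrite mulr_gt0. Qed.
Let u0 x : 0 <= u x. Proof. by rewrite divr_ge0// ltW. Qed.
Let m_u : measurable_fun setT u.
Proof. by apply: measurable_funM => //; exact: measurableT_comp. Qed.
Let hu x : `|h x| = 2 * C * u x.
Proof. by rewrite /u mulrC divfK// gt_eqF. Qed.

Let s x : R := if 0 <= h x then 1 else -1.
Let s1 x : `|s x| = 1. Proof. by rewrite /s; case: ifP; rewrite ?normrN normr1. Qed.
Let sh x : s x * h x = `|h x|.
Proof.
rewrite /s; case: ifPn => h0; first by rewrite mul1r ger0_norm.
by rewrite mulN1r ltr0_norm// ltNge.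
Qed.
Let ms : measurable_fun setT s.
Proof. by apply: measurable_fun_ifT => //; exact: measurable_fun_ler. Qed.

(* The extremal function of Hoelder's inequality for [u] is [u ^ (p' - 1)]. *)
Let modular_density_dual_le :
  (\int[mu]_x (modular_density p' u x)%:E <= (2^-1)%:E)%E.
Proof.
have [mw _] := w_fin.
pose v x := u x `^ (fine (p' x) - 1).
have mv : measurable_fun setT v.
  apply: measurable_powR2 => //; apply: measurable_funB => //.
  exact: measurable_fine_exponent.
have v0 x : 0 <= v x by exact: powR_ge0.
(* Truncation to [B n] makes the extremal function a test function. The sets increase with [n], so
   monotone convergence recovers the full integral. *)
pose B n x := [&& p' x != +oo%E, (p x <= n%:R%:E)%E & v x <= n%:R * w x].
have mB n : measurable_fun setT (B n).
  apply: measurable_and.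
    by apply: measurable_neg; apply: measurable_fun_eqe => //; exact: exponent_measurable.
  apply: measurable_and.
    by apply: measurable_fun_lee => //; exact: exponent_measurable.
  by apply: measurable_fun_ler => //; exact: measurable_funM.
pose f n x := if B n x then s x * v x else 0.
have mf n : measurable_fun setT (f n).
  by apply: measurable_fun_ifT => //; exact: measurable_funM.
have tf n : test_function (f n).
  split=> //; exists n => x; rewrite /f; case: ifPn => [/and3P[_ pn vn]|_].
    by rewrite normrM s1 mul1r ger0_norm.
  by rewrite normr0 eqxx mulr_ge0// ltW.
have fE n x : modular_density p (f n) x = if B n x then u x `^ fine (p' x) else 0.
  rewrite /modular_density /f; case: ifPn => [/eqP px|px].
    by rewrite /B px leNgt ltry andbF.
  case: ifPn => [/and3P[p'x _ _]|_]; last first.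
    by rewrite normr0 powR0// gt_eqF// (lt_le_trans ltr01)// fineq_ge1.
  have [r1 s1' rs] := fine_dual_exponent px p'x.
  rewrite normrM s1 mul1r ger0_norm// /v -powRrM; congr (_ `^ _).
  rewrite -/p' in s1' rs *.
  have r0 : fine (p x) != 0 by rewrite gt_eqF// (lt_trans ltr01).
  have s0 : fine (p' x) != 0 by rewrite gt_eqF// (lt_le_trans ltr01).
  (* Clearing denominators gives [p' + p = p p'], that is [(p' - 1) p = p']. *)
  have := congr1 (fun t => t * (fine (p x) * fine (p' x))) rs.
  rewrite mulrDl mul1r mulKf// mulrCA mulVf// mulr1 => e.
  by rewrite mulrBl mul1r [_ * fine (p x)]mulrC -e addrK.
have fh n x : 2 * C * modular_density p (f n) x <= f n x * h x.
  rewrite fE /f; case: ifPn => [/and3P[p'x _ _]|_]; last by rewrite mulr0 mul0r.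
  rewrite [leRHS]mulrAC sh hu -[leRHS]mulrA /v mulr_powRB1//.
  by rewrite (lt_le_trans ltr01)// fineq_ge1.
have f2 n : (\int[mu]_x (modular_density p (f n) x)%:E <= (2^-1)%:E)%E.
  by rewrite -modularE//; exact: extremal_modular_le.
have nd x : nondecreasing_seq (fun n => (modular_density p (f n) x)%:E).
  move=> m n mn; rewrite !fE lee_fin.
  case: ifPn => [/and3P[p'x pm vm]|_]; last by case: ifP => // _; exact: powR_ge0.
  rewrite ifT//; apply/and3P; split=> //.
    by rewrite (le_trans pm)// lee_fin ler_nat.
  by rewrite (le_trans vm)// ler_wpM2r ?ler_nat// ltW.
have mD n : measurable_fun setT (fun x => (modular_density p (f n) x)%:E).
  by apply/measurable_EFinP; exact: measurable_modular_density.
have := @cvg_monotone_convergence _ _ _ mu setT measurableT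
  (fun n x => (modular_density p (f n) x)%:E) mD
  (fun n x _ => (modular_density_ge0 p (f n) x : (0 <= (_)%:E)%E)) (fun x _ => nd x).
move=> cI.
have lI : (\int[mu]_x limn (fun n => (modular_density p (f n) x)%:E) <= (2^-1)%:E)%E.
  rewrite -(cvg_lim _ cI)//; apply: lime_le.
    by apply/cvg_ex; eexists; exact: cI.
  by apply: nearW => n; exact: f2.
apply: le_trans lI; rewrite le_eqVlt; apply/orP; left; apply/eqP.
apply: ae_eq_integral => //.
- by apply/measurable_EFinP; exact: measurable_modular_density.
- apply: (emeasurable_fun_cvg (fun n x => (modular_density p (f n) x)%:E)) => // x _.
  exact: ereal_nondecreasing_is_cvgn.
apply: filterS (exponent_fin_ae p_fin) => x px _; apply/esym.
apply: (@lim_near_cst) => //; near=> n; rewrite fE /modular_density.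
rewrite (ger0_norm (u0 x)) /B.
have [//|p'x] /= := eqVneq (p' x) +oo%E.
rewrite ifT//; apply/andP; split.
  have pf : p x \is a fin_num.
    by rewrite fin_numE px andbT gt_eqF// (lt_le_trans _ (exponent_ge1 p x))// ltNyr.
  rewrite -(fineK pf) lee_fin; near: n; exact: nbhs_infty_ger.
rewrite -ler_pdivrMr//; near: n; exact: nbhs_infty_ger.
Unshelve. all: by end_near. Qed.

(* Where [p = 1], testing with [N * sgn h] on [A] gives [N * mu A <= 1 / 2] for
   every [N]. *)
Let dual_ae_le : \forall x \ae mu, p' x = +oo%E -> u x <= 1.
Proof.
have [mw _] := w_fin.
(* The condition [1 <= n w] lets a multiple of [w] dominate the indicator; as [w > 0], the union
   over [n] is the whole exceptional set. *)
pose B n x := [&& p' x == +oo%E, 1 < u x & 1 <= n%:R * w x].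
have mB n : measurable_fun setT (B n).
  apply: measurable_and; first by apply: measurable_fun_eqe => //; exact: exponent_measurable.
  apply: measurable_and; first exact: measurable_fun_ltr.
  by apply: measurable_fun_ler => //; exact: measurable_funM.
pose A n := [set x | B n x].
have mA n : measurable (A n).
  by have := mB n measurableT [set true] I; rewrite setTI.
have A0 n : mu (A n) = 0%E.
  pose f N x := if B n x then N%:R * s x else 0 : R.
  have mf N : measurable_fun setT (f N).
    by apply: measurable_fun_ifT => //; exact: measurable_funM.
  have tf N : test_function (f N).
    (* The successor secures [p x = 1 <= m] uniformly, including [N * n = 0]. *)
    split=> //; exists (N * n).+1 => x; rewrite /f; case: ifPn => [/and3P[/eqP p'x _ wn]|_].
      split=> [|_]; last first.
        by rewrite (dual_exponent_eqy p'x) lee_fin ler1n.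
      rewrite normrM s1 mulr1 normr_nat (@le_trans _ _ (N%:R * (n%:R * w x)))//.
        by rewrite ler_peMr.
      by rewrite mulrA -natrM ler_wpM2r ?ler_nat// ltW.
    by rewrite normr0 eqxx mulr_ge0// ltW.
  have fE N x : modular_density p (f N) x = N%:R * \1_(A n) x.
    rewrite /modular_density /f indicE; case: (boolP (B n x)) => Bx.
      rewrite mem_set//; have /and3P[/eqP p'x _ _] := Bx.
      by rewrite (dual_exponent_eqy p'x)/= powRr1// normrM s1 mulr1 normr_nat mulr1.
    rewrite memNset; last exact/negP.
    rewrite mulr0; case: ifPn => // px.
    by rewrite normr0 powR0// gt_eqF// (lt_le_trans ltr01)// fineq_ge1.
  have key N : (N%:R%:E * mu (A n) <= (2^-1)%:E)%E.
    have := extremal_modular_le (tf N).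
    rewrite modularE// (_ : (\int[mu]_x _)%E = (N%:R%:E * mu (A n))%E); last first.
      under eq_integral do rewrite fE EFinM.
      rewrite ge0_integralZl//; last 2 first.
      - by rewrite integral_indic// setIT.
      - by apply/measurable_EFinP; exact: measurable_indic.
    apply=> x; rewrite fE /f indicE; case: (boolP (B n x)) => Bx; last first.
      by rewrite memNset; [rewrite !mulr0 mul0r|exact/negP].
    have /and3P[_ ux _] := Bx.
    rewrite mem_set// mulr1 -[leRHS]mulrA sh hu [leLHS]mulrC.
    by rewrite ler_wpM2l// ler_peMr// ltW.
  have mAfin : mu (A n) \is a fin_num.
    by rewrite ge0_fin_numE// (le_lt_trans _ (ltry 2^-1))//; have := key 1; rewrite mul1e.
  apply/eqP; rewrite eq_le measure_ge0 andbT -(fineK mAfin) lee_fin leNgt.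
  apply/negP => a0.
  (* This integer exceeds [1 / mu (A n)], so its product with [mu (A n)] exceeds 1. *)
  have := key (truncn (fine (mu (A n)))^-1).+1.
  rewrite -(fineK mAfin) -EFinM lee_fin leNgt => /negP; apply.
  rewrite (@lt_trans _ _ 1)//; first by rewrite invf_lt1// ltr1n.
  by rewrite -ltr_pdivrMr// mul1r truncnS_gt.
have A00 : mu.-negligible (\bigcup_n A n).
  by apply: negligible_bigcup => n; exists (A n); split.
apply: negligibleS A00 => x /= /not_implyP[p'x /negP]; rewrite -ltNge => ux.
exists (truncn (w x)^-1).+1 => //; apply/and3P; split=> //; first exact/eqP.
by rewrite -ler_pdivrMr// mul1r ltW// truncnS_gt.
Qed.

(** The integral part of the modular of [h / (2 C)] is at most 1/2 and the supremum part at most 1.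
    Halving the function once more brings the total 3/2 below 1, whence [4 C]. *)
Lemma dual_luxemburg_le : h \in vLfun mu p' /\ luxemburg mu p' h <= 4 * C.
Proof.
have mhC : measurable_fun setT (fun x => h x / (2 * C)) by exact: measurable_funM.
have m32 : (modular mu p' (fun x => h x / (2 * C))%R <= (3 / 2)%:E)%E.
  have -> : 3 / 2 = 2^-1 + 1 :> R by lra.
  rewrite EFinD /modular integral_exponent_fin; apply: leeD.
    apply: le_trans modular_density_dual_le.
    rewrite le_eqVlt; apply/orP; left; apply/eqP; apply: eq_integral => x _.
    rewrite /modular_density/= /u normrM (gtr0_norm (_ : 0 < (2 * C)^-1)) ?invr_gt0//.
    by rewrite normrM normr_id (gtr0_norm (_ : 0 < (2 * C)^-1)) ?invr_gt0.
  rewrite unlock; case: ifPn => // _; apply/ess_supP.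
  apply: filterS dual_ae_le => x ux /=; rewrite lee_fin patchE.
  case: ifPn => [/set_mem/= /ux|_]; last by rewrite normr0.
  by rewrite /u normrM (gtr0_norm (_ : 0 < (2 * C)^-1)) ?invr_gt0.
have m1 : (modular mu p' (fun x => h x / (4 * C))%R <= 1)%E.
  rewrite (_ : (fun x => _) = (fun x => 2^-1 * (h x / (2 * C)))); last first.
    by apply/funext => x; field; rewrite gt_eqF.
  rewrite (le_trans (modular_scale _ _ _ _))//.
    by lra.
  rewrite (@le_trans _ _ ((2^-1)%:E * (3 / 2)%:E)%E)//.
    by rewrite lee_pmul ?modular_ge0 ?lee_fin.
  by rewrite -EFinM lee_fin; lra.
have C40 : 0 < 4 * C by rewrite mulr_gt0.
split; last exact: luxemburg_le.
by apply/vLfunP; split=> //; exists (4 * C).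
Qed.

End dual_norm_bound.

End test_functions.

(** * Representation by Radon-Nikodym *)

Section representation.
Context d (T : measurableType d) (R : realType).
Variables (mu : {sigma_finite_measure set T -> \bar R}) (p : exponent T R).
Hypothesis p_fin : mu [set x | p x = +oo%E] = 0%E.
Variables (Phi : (T -> R) -> R) (C : R).
Hypotheses (C0 : 0 < C)
  (Phi_linear : forall (a : R) (f g : T -> R), f \in vLfun mu p -> g \in vLfun mu p ->
    Phi (fun x => a * f x + g x) = a * Phi f + Phi g)
  (Phi_bounded : forall f : T -> R, f \in vLfun mu p -> `|Phi f| <= C * luxemburg mu p f).

Let vL0 : (cst 0 : T -> R) \in vLfun mu p.
Proof. by apply: vLfun_modular => //; rewrite modular0 ltry. Qed.

Let Phi0 : Phi (cst 0) = 0.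
Proof.
by apply/eqP; rewrite -normr_le0 (le_trans (Phi_bounded vL0))// luxemburg0 mulr0.
Qed.

Let PhiD (f g : T -> R) : f \in vLfun mu p -> g \in vLfun mu p ->
  Phi (fun x => f x + g x) = Phi f + Phi g.
Proof.
move=> fV gV; have := Phi_linear 1 fV gV; rewrite mul1r => <-.
by under [in RHS]eq_fun do rewrite mul1r.
Qed.

Let PhiB (f g : T -> R) : f \in vLfun mu p -> g \in vLfun mu p ->
  Phi (fun x => f x - g x) = Phi f - Phi g.
Proof.
move=> fV gV; have := Phi_linear (-1) gV fV; rewrite mulN1r addrC => <-.
by under [in RHS]eq_fun do rewrite mulN1r addrC.
Qed.

(** Boundedness of [Phi] transfers dominated convergence in norm; the differences [g0 - g n] are
    dominated by [2 f]. *)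
Let Phi_cvg (f : T -> R) (g : (T -> R)^nat) (g0 : T -> R) : finite_element mu p f ->
  (forall n, measurable_fun setT (g n)) -> (forall n x, `|g n x| <= `|f x|) ->
  measurable_fun setT g0 -> (forall x, `|g0 x| <= `|f x|) ->
  (forall x, g ^~ x @ \oo --> g0 x) -> Phi \o g @ \oo --> Phi g0.
Proof.
move=> ff mg gf mg0 g0f gg0.
have gV n : g n \in vLfun mu p.
  by apply: (le_vLfun p_fin (mg n) (finite_element_vLfun ff)) => x; exact: gf.
have g0V : g0 \in vLfun mu p by exact: (le_vLfun p_fin mg0 (finite_element_vLfun ff)).
apply/cvgrPdist_le => e e0.
have := @luxemburg_dominated_cvg0 _ _ _ mu p p_fin (fun x => 2 * f x)
  (fun n x => g0 x - g n x) (finite_elementZ 2 ff) _ _ _ (e / C) (divr_gt0 e0 C0).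
move=> /(_ _ _ _)[].
- by move=> n; exact: measurable_funB.
- move=> n x; rewrite normrM ger0_norm// mulr2n mulrDl mul1r.
  by rewrite (le_trans (ler_normB _ _))// lerD.
- apply: aeW => x; rewrite -(subrr (g0 x)).
  by apply: cvgB; [exact: cvg_cst|exact: gg0].
move=> N _ HN; exists N => // n /HN/=; rewrite -PhiB// => gn.
have mgn : measurable_fun setT (fun x => g0 x - g n x) by exact: measurable_funB.
rewrite (le_trans (Phi_bounded _))//.
  apply: (le_vLfun p_fin mgn (finite_element_vLfun (finite_elementZ 2 ff))) => x.
  rewrite normrM ger0_norm// mulr2n mulrDl mul1r.
  by rewrite (le_trans (ler_normB _ _))// lerD.
by rewrite -ler_pdivlMl// mulrC.
Qed.

Variable w : T -> R.
Hypotheses (w_fin : finite_element mu p w) (w_gt0 : forall x, 0 < w x).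

Let mw : measurable_fun setT w. Proof. by case: w_fin. Qed.

Let mwindic A : measurable A -> measurable_fun setT (fun x => w x * \1_A x).
Proof. by move=> mA; apply: measurable_funM => //; exact: measurable_indic. Qed.

Let le_windic A x : `|w x * \1_A x| <= `|w x|.
Proof. by rewrite normrM ler_piMr// indicE; case: (_ \in _); rewrite ?normr1 ?normr0. Qed.

Let windicV A : measurable A -> (fun x => w x * \1_A x) \in vLfun mu p.
Proof.
by move=> mA; exact: (le_vLfun p_fin (mwindic mA) (finite_element_vLfun w_fin)).
Qed.

(** The weight stands in for the constant 1, since indicators of sets of infinite measure need not
    lie in [L^p]. *)
Let nu (A : set T) : \bar R := (Phi (fun x => w x * \1_A x))%:E.

Let nu0 : nu set0 = 0%E.
Proof.
rewrite /nu -[RHS]/(0%R%:E) -Phi0; congr (Phi _)%:E.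
by apply/funext => x; rewrite indic0 mulr0.
Qed.

Let nu_fin A : measurable A -> nu A \is a fin_num. Proof. by []. Qed.

(** Finite additivity is linearity of [Phi]. The passage to countable unions is [Phi_cvg] for the
    partial unions, dominated by [w]. *)
Let nu_sigma_additive : semi_sigma_additive nu.
Proof.
move=> F mF tF mUF.
pose U n := \big[setU/set0]_(i < n) F i.
have mU n : measurable (U n) by exact: bigsetU_measurable.
have UE n : (\sum_(0 <= i < n) nu (F i))%E = nu (U n).
  elim: n => [|n ih]; first by rewrite big_nil /U big_ord0 nu0.
  rewrite big_nat_recr//= ih /nu -EFinD -PhiD; [|exact: windicV|exact: windicV].
  congr (Phi _)%:E; apply/funext => x; rewrite -mulrDr; congr (_ * _).
  rewrite /U big_ord_recr/= -/(U n) !indicE in_setU.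
  have [Ux|//] := boolP (x \in U n); last by rewrite add0r.
  rewrite /= (_ : (x \in F n) = false) ?addr0//.
  apply/negP => /set_mem Fx; move: Ux => /set_mem; rewrite /U -bigcup_mkord.
  move=> [k /= kn Fkx]; have := tF k n I I (ex_intro _ x (conj Fkx Fx)).
  by move=> kn'; rewrite kn' ltnn in kn.
under eq_fun do rewrite UE.
apply: cvg_EFin; first exact: nearW.
apply: (@Phi_cvg w) => //.
- by move=> n; exact: mwindic.
- exact: mwindic.
move=> x; apply: cvgM; first exact: cvg_cst.
apply: cvg_near_cst.
have [[k _ Fkx]|nFx] := pselect ((\bigcup_n F n) x).
  exists k.+1 => // n /= kn; rewrite !indicE !mem_set//; first by exists k.
  by rewrite /U -bigcup_mkord; exists k.
apply: nearW => n; rewrite !indicE !memNset//.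
by rewrite /U -bigcup_mkord => -[k _ Fkx]; apply: nFx; exists k.
Qed.

Let nu_dominated : nu `<< mu.
Proof.
apply/null_content_dominatesP => A mA A0; congr EFin.
apply/eqP; rewrite -normr_le0 (le_trans (Phi_bounded (windicV mA)))//.
rewrite (@eq_luxemburg _ _ _ mu p _ (cst 0)) ?luxemburg0 ?mulr0//.
  exact: mwindic.
exists A; split=> // x /=; apply: contra_notP => Ax.
by rewrite indicE memNset ?mulr0.
Qed.

Let exists_derivative : exists k : T -> R, mu.-integrable setT (EFin \o k) /\
  forall A, measurable A -> (\int[mu]_x (\1_A x * k x)%:E)%E = nu A.
Proof.
pose nuC : {charge set T -> \bar R} :=
  HB.pack nu (isCharge.Build _ _ _ nu nu0 nu_fin nu_sigma_additive).
pose k0 := Radon_Nikodym nuC mu.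
have kE x : (fine (k0 x))%:E = k0 x by rewrite fineK// Radon_Nikodym_fin_num.
exists (fine \o k0); split.
  rewrite (_ : EFin \o _ = k0); first exact: Radon_Nikodym_integrable.
  by apply/funext => x /=; exact: kE.
move=> A mA; rewrite -[RHS]/(nuC A).
rewrite (@Radon_Nikodym_integral _ _ _ nuC mu _ nu_dominated mA).
rewrite [RHS]integral_mkcond; apply: eq_integral => x _.
rewrite EFinM kE patchE indicE; case: ifPn => _; first by rewrite mul1e.
by rewrite mul0e.
Qed.

Let sum_functional (n : nat) (c : nat -> R) (A : nat -> set T) (k : T -> R) :
  mu.-integrable setT (EFin \o k) ->
  (forall A, measurable A -> (\int[mu]_x (\1_A x * k x)%:E)%E = nu A) ->
  (forall i, measurable (A i)) ->
  (fun x => w x * \sum_(i < n) c i * \1_(A i) x) \in vLfun mu p /\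
  (\int[mu]_x ((\sum_(i < n) c i * \1_(A i) x) * k x)%:E)%E =
  (Phi (fun x => w x * \sum_(i < n) c i * \1_(A i) x))%:E.
Proof.
move=> ik kE mA.
have i1 B : measurable B -> mu.-integrable setT (fun x => (\1_B x * k x)%:E).
  move=> mB; apply: (le_integrable measurableT _ _ ik) => //.
    apply/measurable_EFinP; apply: measurable_funM; first exact: measurable_indic.
    by apply/measurable_EFinP; exact: measurable_int ik.
  move=> x _; rewrite /= lee_fin normrM ler_piMl//.
  by rewrite indicE; case: (_ \in _); rewrite ?normr1 ?normr0.
(* Integrability joins the induction because splitting the integral of a sum needs it. *)
suff : [/\ (fun x => w x * \sum_(i < n) c i * \1_(A i) x) \in vLfun mu p,
  mu.-integrable setT (fun x => ((\sum_(i < n) c i * \1_(A i) x) * k x)%:E) &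
  (\int[mu]_x ((\sum_(i < n) c i * \1_(A i) x) * k x)%:E)%E =
  (Phi (fun x => w x * \sum_(i < n) c i * \1_(A i) x))%:E] by case.
elim: n => [|n [ihV ihi ihE]].
  have w0 : (fun x => w x * \sum_(i < 0) c i * \1_(A i) x) = cst 0.
    by apply/funext => x; rewrite big_ord0 mulr0.
  split; first by rewrite w0.
    by under eq_fun do rewrite big_ord0 mul0r; exact: integrable0.
  by rewrite w0 Phi0; under eq_integral do rewrite big_ord0 mul0r; rewrite integral0.
have wE : (fun x => w x * \sum_(i < n.+1) c i * \1_(A i) x) =
    (fun x => c n * (w x * \1_(A n) x) + w x * \sum_(i < n) c i * \1_(A i) x).
  by apply/funext => x; rewrite big_ord_recr/=; ring.
have kEq x : ((\sum_(i < n.+1) c i * \1_(A i) x) * k x)%:E =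
    ((c n)%:E * (\1_(A n) x * k x)%:E + ((\sum_(i < n) c i * \1_(A i) x) * k x)%:E)%E.
  by rewrite -EFinM -EFinD big_ord_recr/=; congr EFin; ring.
have ic : mu.-integrable setT (fun x => ((c n)%:E * (\1_(A n) x * k x)%:E)%E).
  by apply: integrableZl => //; exact: i1.
split.
- rewrite wE.
  exact: ((vLfun_submod_closed mu p).2 _ _ _ (windicV (mA n)) ihV).
- by under eq_fun do rewrite kEq; exact: integrableD.
- rewrite wE Phi_linear//; last exact: windicV.
  under eq_integral do rewrite kEq.
  rewrite integralD// integralZl//; last exact: i1.
  by rewrite kE// ihE.
Qed.

Import HBSimple HBNNSimple.

(* Radon-Nikodym applied to the charge [A |-> Phi (w * \1_A)] yields the
   density [k = w * h]. *)
Lemma exists_test_density : exists2 h : T -> R, measurable_fun setT h &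
  forall (f : T -> R) (m : nat), measurable_fun setT f -> (forall x, `|f x| <= m%:R * w x) ->
    mu.-integrable setT (EFin \o (fun x => f x * h x)) /\
    (\int[mu]_x (f x * h x)%:E)%E = (Phi f)%:E.
Proof.
have [k [ik kE]] := exists_derivative.
have mk : measurable_fun setT k by apply/measurable_EFinP; exact: measurable_int ik.
have mV : measurable_fun setT (fun x => (w x)^-1).
  rewrite (_ : (fun x => _) = (fun x => w x `^ (-1))).
    exact: (measurableT_comp (measurable_powR _)).
  by apply/funext => x; rewrite powR_inv1// ltW.
pose h x := (w x)^-1 * k x.
exists h; first exact: measurable_funM.
have int (f : T -> R) m : measurable_fun setT f -> (forall x, `|f x| <= m%:R * w x) ->
    mu.-integrable setT (EFin \o (fun x => f x * h x)).
  move=> mf fm; apply: (le_integrable measurableT _ _ (integrableZl measurableT m%:R ik)) => //.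
    by apply/measurable_EFinP; do 2 apply: measurable_funM => //.
  move=> x _; rewrite /= lee_fin /h mulrA !normrM ler_wpM2r//.
  rewrite normfV (gtr0_norm (w_gt0 x)) ler_pdivrMr// normr_nat//.
(* Approximation from below by simple functions needs a sign, so [f] is split into its positive and
   negative parts, both under the same bound. *)
suff pos (f : T -> R) m : measurable_fun setT f -> (forall x, 0 <= f x) ->
    (forall x, `|f x| <= m%:R * w x) -> (\int[mu]_x (f x * h x)%:E)%E = (Phi f)%:E.
  move=> f m mf fm; split; first exact: int fm.
  have mx : measurable_fun setT (fun x => Num.max (f x) 0) by exact: measurable_maxr.
  have mn : measurable_fun setT (fun x => Num.max (- f x) 0).
    by apply: measurable_maxr => //; exact: measurableT_comp.
  have xb x : `|Num.max (f x) 0| <= m%:R * w x.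
    apply: le_trans (fm x); rewrite ger0_norm; last by rewrite le_max lexx orbT.
    by rewrite ge_max normr_ge0 ler_norm.
  have nb x : `|Num.max (- f x) 0| <= m%:R * w x.
    apply: le_trans (fm x); rewrite ger0_norm; last by rewrite le_max lexx orbT.
    by rewrite ge_max normr_ge0 -normrN ler_norm.
  have fE x : f x = Num.max (f x) 0 - Num.max (- f x) 0.
    rewrite !maxEle; case: ifPn => a; case: ifPn => b; lra.
  have bV (g : T -> R) : measurable_fun setT g ->
      (forall x, `|g x| <= m%:R * w x) -> g \in vLfun mu p.
    move=> mg gb; apply: (le_vLfun p_fin mg (finite_element_vLfun (finite_elementZ m%:R w_fin))).
    by move=> x; rewrite [leRHS]ger0_norm// mulr_ge0// ltW.
  rewrite [in RHS](_ : f = (fun x => Num.max (f x) 0 - Num.max (- f x) 0)); last first.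
    by apply/funext.
  rewrite PhiB; [|exact: bV|exact: bV].
  rewrite EFinB -(pos _ m mx)//; last by move=> x; rewrite le_max lexx orbT.
  rewrite -(pos _ m mn)//; last by move=> x; rewrite le_max lexx orbT.
  rewrite -integralB//; [|exact: int xb|exact: int nb].
  by apply: eq_integral => x _; rewrite -EFinB -mulrBl -fE.
move=> mf f0 fm.
(* Approximating [f / w] rather than [f] produces simple multiples of [w], for which the identity is
   [sum_functional]. *)
pose u x := (w x)^-1 * f x.
have wu x : w x * u x = f x by rewrite /u mulVKf// gt_eqF.
have u0 x : 0 <= u x by rewrite mulr_ge0// invr_ge0 ltW.
have mEu : measurable_fun setT (EFin \o u).
  by apply/measurable_EFinP; exact: measurable_funM.
have u0' x : [set: T] x -> (0 <= (EFin \o u) x)%E by move=> _; rewrite lee_fin.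
pose a n := nnsfun_approx measurableT mEu n.
have a0 n x : 0 <= a n x by [].
have au n x : a n x <= u x.
  by rewrite -lee_fin /a nnsfun_approxE; exact: le_approx.
have aw n x : `|w x * a n x| <= m%:R * w x.
  rewrite ger0_norm; last by rewrite mulr_ge0// ltW.
  rewrite (le_trans _ (fm x))// ger0_norm// -wu ler_wpM2l// ltW//.
have ca x : a ^~ x @ \oo --> u x.
  have := cvg_nnsfun_approx measurableT mEu u0' (I : [set: T] x).
  by move=> /fine_cvgP[].
have ma n : measurable_fun setT (a n) by exact: measurable_funTS.
have aE n : (\int[mu]_x ((w x * a n x) * h x)%:E)%E = (Phi (fun x => w x * a n x))%:E.
  have [s sE] : exists s : seq R, forall x,
      a n x = \sum_(i < size s) s`_i * \1_(a n @^-1` [set s`_i]) x.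
    by exists (finmap.enum_fset (fset_set (a n @` setT))) => x; exact: fimfunEord.
  have [_] := sum_functional (size s) (A := fun i => a n @^-1` [set s`_i]) (fun i => s`_i) ik kE
    (fun i => measurable_funPTI (a n) (measurable_set1 _)).
  under eq_integral do rewrite -sE.
  under [X in Phi X]eq_fun do rewrite -sE.
  move=> <-; apply: eq_integral => x _; congr EFin.
  by rewrite /h [w x * _]mulrC mulrA mulfK// gt_eqF.
have cPhi : (Phi \o (fun n x => w x * a n x)) @ \oo --> Phi f.
  apply: (@Phi_cvg (fun x => m%:R * w x)).
  - exact: finite_elementZ.
  - by move=> n; exact: measurable_funM.
  - by move=> n x; rewrite [leRHS]ger0_norm// mulr_ge0// ltW.
  - exact: mf.
  - by move=> x; rewrite [leRHS]ger0_norm// mulr_ge0// ltW.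
  - by move=> x; rewrite -wu; apply: cvgM => //; exact: cvg_cst.
(* The factor [w] cancels: [|w a_n h| <= m w |k| / w = m |k|], which is integrable. *)
have [] := @dominated_convergence _ _ _ mu setT measurableT
  (fun n x => ((w x * a n x) * h x)%:E) (fun x => (f x * h x)%:E)
  (fun x => (m%:R%:E * `|(k x)%:E|)%E).
- move=> n; apply/measurable_EFinP.
  by apply: measurable_funM => //; exact: measurable_funM.
- by apply/measurable_EFinP; apply: measurable_funM => //; exact: measurable_funM.
- apply: aeW => x _; apply: cvg_EFin; first exact: nearW.
  apply: cvgM; last exact: cvg_cst.
  by rewrite -wu; apply: cvgM => //; exact: cvg_cst.
- by apply: integrableZl => //; exact: integrable_abse.
- apply: aeW => x n _; rewrite -EFinM lee_fin /h mulrA !normrM ler_wpM2r//.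
  rewrite -normrM normfV (gtr0_norm (w_gt0 x)) ler_pdivrMr//.
move=> _ _ cI; apply/esym; apply: (cvg_unique _ _ cI) => //.
rewrite (_ : [sequence _]_n = EFin \o (Phi \o (fun n x => w x * a n x))).
  by apply: cvg_EFin; [exact: nearW|exact: cPhi].
by apply/funext => n /=; exact: aE.
Qed.

End representation.

(** * Duality between [L^{p'}] and the finite elements of [L^p] *)

Section finite_duality.
Context d (T : measurableType d) (R : realType).
Variables (mu : {sigma_finite_measure set T -> \bar R}) (p : exponent T R).
Hypothesis p_fin : mu [set x | p x = +oo%E] = 0%E.
Let p' := dual_exponent p.

(** A converse to Hoelder's inequality: functions of bounded exponent already detect the norm of
    [h], because test functions are among them. *)
Lemma luxemburg_dual_le (h : T -> R) (C : R) : h \in vLfun mu p' -> 0 < C ->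
  (forall f : T -> R, f \in vLfun mu p ->
    (exists M : R, forall x, f x != 0 -> (p x <= M%:E)%E) ->
    \int[mu]_x (f x * h x) <= C * luxemburg mu p f) ->
  luxemburg mu p' h <= 4 * C.
Proof.
move=> hV C0 hC; have [w w_fin w_gt0] := exists_finite_weight p_fin.
have [mh _] := (vLfunP _ _ _).1 hV.
have [] // := dual_luxemburg_le p_fin w_fin w_gt0 mh C0 _.
move=> f tf; have fV := finite_element_vLfun (test_function_finite_element p_fin w_fin w_gt0 tf).
split; first exact: (vLfun_integrableM p_fin fV hV).
by apply: hC => //; have [_ [m fm]] := tf; exists m%:R => x; exact: (fm x).2.
Qed.

(** The density [h] first represents [Phi] on test functions only. This suffices to bound its norm,
    and then both sides are continuous and agree on a dense subset of the finite elements. *)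
Lemma bounded_functional_representation (Phi : (T -> R) -> R) (C : R) :
  (forall (a : R) (f g : T -> R), f \in vLfun mu p -> g \in vLfun mu p ->
    Phi (fun x => a * f x + g x) = a * Phi f + Phi g) ->
  (forall f : T -> R, f \in vLfun mu p -> `|Phi f| <= C * luxemburg mu p f) ->
  exists2 h : T -> R, h \in vLfun mu p' &
    forall f : T -> R, finite_element mu p f -> Phi f = \int[mu]_x (f x * h x).
Proof.
move=> Phi_linear PhiC; have [w w_fin w_gt0] := exists_finite_weight p_fin.
pose K := Num.max 1 C; have K0 : 0 < K by rewrite lt_max ltr01.
have PhiK (f : T -> R) : f \in vLfun mu p -> `|Phi f| <= K * luxemburg mu p f.
  move=> fV; rewrite (le_trans (PhiC f fV))// ler_wpM2r ?luxemburg_ge0//.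
  by rewrite le_max lexx orbT.
have [h mh hE] := exists_test_density p_fin K0 Phi_linear PhiK w_fin w_gt0.
have tE (f : T -> R) : test_function p w f -> Phi f = \int[mu]_x (f x * h x).
  move=> [mf [m fm]]; have [_ E] := hE f m mf (fun x => (fm x).1).
  by rewrite /Rintegral E.
have hV : h \in vLfun mu p'.
  have [] // := dual_luxemburg_le p_fin w_fin w_gt0 mh K0 _.
  move=> f tf; rewrite -tE//; split.
    by have [mf [m fm]] := tf; have [] := hE f m mf (fun x => (fm x).1).
  rewrite (le_trans (ler_norm _))// PhiK//.
  exact: finite_element_vLfun (test_function_finite_element p_fin w_fin w_gt0 tf).
exists h => // f ff; apply/eqP; rewrite -subr_eq0 -normr_le0; apply/ler_addgt0Pr => e e0.
rewrite add0r; have fV := finite_element_vLfun ff.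
(* This is a Lipschitz constant of [Phi f - \int f h]: boundedness of [Phi] plus Hoelder's
   inequality. *)
pose L := K + 2 * luxemburg mu p' h.
have L0 : 0 < L by rewrite ltr_wpDr// mulr_ge0// luxemburg_ge0.
have [g tg fg] := test_function_dense p_fin w_fin w_gt0 ff (divr_gt0 e0 L0).
have gV := finite_element_vLfun (test_function_finite_element p_fin w_fin w_gt0 tg).
have fgE : (fun x => f x - g x) = (fun x => -1 * g x + f x).
  by apply/funext => x; rewrite mulN1r addrC.
have fgV : (fun x => f x - g x) \in vLfun mu p.
  by rewrite fgE; exact: ((vLfun_submod_closed mu p).2 (-1) g f gV fV).
have -> : Phi f - \int[mu]_x (f x * h x) =
    Phi (fun x => f x - g x) - \int[mu]_x ((f x - g x) * h x).
  under [in RHS]eq_Rintegral do rewrite mulrBl.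
  rewrite RintegralB//; [|exact: (vLfun_integrableM p_fin _ hV)..].
  by rewrite fgE Phi_linear// mulN1r -(tE g tg); ring.
rewrite (le_trans (ler_normB _ _))//.
rewrite (@le_trans _ _ (L * luxemburg mu p (fun x => f x - g x)))//; last first.
  by rewrite mulrC -ler_pdivlMr.
rewrite mulrDl lerD//; first exact: PhiK.
by rewrite (le_trans (hoelder_Rintegral p_fin fgV hV))// mulrAC.
Qed.

End finite_duality.

(** * Functionals on quotients and on the germ space *)

Section bounded_functionals.
Context (R : realType).
Implicit Types V W : normedModType R.

(** The lower bound gives injectivity and bounds the inverse. The isomorphism returned is that
    inverse, so the explicit map may start from the direct sum. *)
Lemma isomorphic_inverse V W (g : W -> V) (c C : R) : linear g ->
  (forall x, `|g x| <= C * `|x|) -> (forall x, `|x| <= c * `|g x|) ->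
  (forall y, exists x, g x = y) -> isomorphic V W.
Proof.
move=> lg gC gc gs.
pose gL : {linear W -> V} := HB.pack g (GRing.isLinear.Build _ _ _ _ _ lg).
have gI : injective g.
  move=> x y xy; apply/eqP; rewrite -subr_eq0 -normr_le0 (le_trans (gc _))//.
  by rewrite -[g]/(gL : W -> V) raddfB /= xy subrr normr0 mulr0.
pose f y := sval (cid (gs y)).
have fK y : g (f y) = y by rewrite /f; case: cid.
have lf : linear f.
  by move=> a u v; apply: gI; rewrite fK lg !fK.
pose fL : {linear V -> W} := HB.pack f (GRing.isLinear.Build _ _ _ _ _ lf).
exists fL, g; split=> //.
- by move=> x /=; apply: gI; rewrite fK.
- by exists c => x /=; rewrite (le_trans (gc _))// fK.
- by exists C.
Qed.

Definition mk_dual V (f : V -> R^o) (lf : linear f) (bf : bounded_map f) : dual V :=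
  Dual (asboolT (conj lf bf) : f \in @functional_pred R V).

Section dual_theory.
Variable V : normedModType R.
Implicit Type f : dual V.

Lemma dual_linear f : linear f.
Proof. by have /asboolP[] := dual_funP f. Qed.

Lemma dual_bounded f : bounded_map f.
Proof. by have /asboolP[] := dual_funP f. Qed.

Lemma dual0 f : f 0 = 0.
Proof.
have := dual_linear f (-1) 0 0; rewrite scaler0 addr0 => {1}->.
by rewrite scaleN1r addNr.
Qed.

Lemma dualB f u v : f (u - v) = f u - f v.
Proof. by rewrite addrC -scaleN1r dual_linear scaleN1r addrC. Qed.

Lemma dual_norm_le f (C : R) : 0 <= C -> (forall x, `|f x| <= C * `|x|) -> `|f| <= C.
Proof.
move=> C0 fC; apply: ge_sup; first by exists `|f 0|, 0 => //=; rewrite normr0.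
by move=> _ [x /= x1 <-]; rewrite (le_trans (fC x))// ler_piMr.
Qed.

Lemma ler_dual_norm f x : `|f x| <= `|f| * `|x|.
Proof.
have [->|x0] := eqVneq x 0; first by rewrite dual0 !normr0 mulr0.
have nx0 : 0 < `|x| by rewrite normr_gt0.
rewrite -ler_pdivrMr//.
have -> : `|f x| / `|x| = `|f (`|x|^-1 *: x)|.
  have := dual_linear f `|x|^-1 x 0; rewrite addr0 dual0 addr0 => ->.
  by rewrite normrZ normfV normr_id mulrC.
apply: ub_le_sup.
  have [C fC] := dual_bounded f; exists `|C| => _ [y /= y1 <-].
  rewrite (le_trans (fC y))// (le_trans (ler_norm _))// normrM normr_id.
  by rewrite ler_piMr.
by exists (`|x|^-1 *: x) => //=; rewrite normrZ normfV normr_id mulVf ?normr_eq0.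
Qed.

Lemma dual_closure0 f (A : set V) : (forall x, A x -> f x = 0) ->
  forall x, closure A x -> f x = 0.
Proof.
move=> fA x /closure_approx Ax; apply/eqP; rewrite -normr_le0; apply/ler_addgt0Pr => e e0.
have f1 : 0 < `|f| + 1 by rewrite ltr_wpDl.
have [y Ay xy] := Ax (e / (`|f| + 1)) (divr_gt0 e0 f1).
rewrite add0r -[f x]subr0 -(fA _ Ay) -dualB (le_trans (ler_dual_norm _ _))//.
move: xy; rewrite ltr_pdivlMr// => /ltW; apply: le_trans.
by rewrite mulrC ler_wpM2l// lerDl.
Qed.

End dual_theory.

Section dual_quotient.
Variables (V : normedModType R) (W : Defs.subspace V) (cW : closed (subspace_set W)).
Local Open Scope quotient_scope.

Definition quotient_map (v : V) : normed_quotient cW := \pi_(quotient_space W) v.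

Lemma quotient_map_linear : linear quotient_map.
Proof.
move=> a u v; rewrite /quotient_map.
by rewrite [LHS](quot_piD W (a *: u) v) (quot_piZ W a u).
Qed.

Lemma quotient_map_norm v : `|quotient_map v| <= `|v|.
Proof.
apply: ge_inf; first by exists 0 => _ [u _ <-].
by exists v.
Qed.

Lemma quotient_map_eq0 v : subspace_set W v -> quotient_map v = 0.
Proof.
move=> Wv; rewrite -[RHS](raddf0 (\pi_(quotient_space W))).
by apply/(quot_eqP W); rewrite subr0.
Qed.

(** A class has representatives of norm arbitrarily close to its own. The proof uses [|C| + 1] as a
    positive divisor, [C] having arbitrary sign. *)
Lemma quotient_bound (f : normed_quotient cW -> R^o) (C : R) :
  (forall v, `|f (quotient_map v)| <= C * `|v|) -> forall x, `|f x| <= C * `|x|.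
Proof.
move=> fC x; apply/ler_addgt0Pr => e e0.
have C1 : 0 < `|C| + 1 by rewrite ltr_wpDl.
have : `|x| < `|x| + e / (`|C| + 1) by rewrite ltrDl divr_gt0.
move=> /inf_lt[|_ [v /= vx <-] vlt].
  by exists `|repr x|, (repr x) => //=; rewrite reprK.
have xv : `|x| <= `|v| by rewrite -vx; exact: quotient_map_norm.
have := fC v; rewrite [quotient_map v]vx => /le_trans; apply.
rewrite -lerBlDl -mulrBr (le_trans (ler_norm _))// normrM.
rewrite (ger0_norm (_ : 0 <= `|v| - `|x|)) ?subr_ge0//.
move: vlt; rewrite -ltrBlDl ltr_pdivlMr// => /ltW; apply: le_trans.
by rewrite mulrC ler_wpM2l ?subr_ge0// lerDl.
Qed.

(** Evaluation at the chosen representative is independent of the choice because [f] vanishes on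
    [W]. *)
Lemma dual_quotient_factor (f : dual V) : (forall v, subspace_set W v -> f v = 0) ->
  exists g : dual (normed_quotient cW), forall v, g (quotient_map v) = f v.
Proof.
move=> fW; pose g (x : normed_quotient cW) : R^o := f (repr x).
have gE v : g (quotient_map v) = f v.
  apply/eqP; rewrite -subr_eq0 -dualB fW//.
  by apply/(quot_eqP W); rewrite reprK.
have gs (x : normed_quotient cW) : exists v, quotient_map v = x.
  by exists (repr x); rewrite /quotient_map reprK.
have lg : linear g.
  move=> a x y; have [u <-] := gs x; have [v <-] := gs y.
  by rewrite -quotient_map_linear !gE dual_linear.
have bg : bounded_map g.
  by exists `|f|; apply: quotient_bound => v; rewrite gE ler_dual_norm.
by exists (mk_dual lg bg) => v; exact: gE.
Qed.

End dual_quotient.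

End bounded_functionals.

(** * The isomorphism with the direct sum *)

Section germ_duality.
Context d (T : measurableType d) (R : realType).
Variables (mu : {sigma_finite_measure set T -> \bar R}) (p : exponent T R).
Hypothesis p_fin : mu [set x | p x = +oo%E] = 0%E.
Local Open Scope quotient_scope.

Local Notation V := (vLspace mu p).
Local Notation V' := (vLspace mu (dual_exponent p)).
Local Notation E := (dual (germ_space mu p)).

Definition germ : V -> germ_space mu p :=
  @quotient_map R V (closure_subspace (vLb_subspace mu p))
    (@closed_closure V (@vLb d T R mu p)).

Lemma germ_linear : linear germ.
Proof. exact: quotient_map_linear. Qed.

Lemma repr_pi_ae (q : exponent T R) (f : vLfunType mu q) :
  \forall x \ae mu, (repr (\pi_(vLspace mu q) f) : vLfunType mu q) x = f x.
Proof.
have : vL_null (repr (\pi_(vLspace mu q) f) - f).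
  by apply/(quot_eqP (vL_null_subspace mu q)); rewrite reprK.
by apply: filterS => x fx; apply/eqP; rewrite -subr_eq0; apply/eqP.
Qed.

Definition pairing (H : V') (F : V) : R :=
  \int[mu]_x ((repr F : vLfunType mu p) x * (repr H : vLfunType mu (dual_exponent p)) x).

Lemma pairing_pi (h : vLfunType mu (dual_exponent p)) (f : vLfunType mu p) :
  pairing (\pi_V' h) (\pi_V f) = \int[mu]_x (f x * h x).
Proof.
congr fine; apply: ae_eq_integral => //.
- by apply/measurable_EFinP; apply: measurable_funM; exact: measurable_vLfun.
- by apply/measurable_EFinP; apply: measurable_funM; exact: measurable_vLfun.
by apply: filterS2 (repr_pi_ae f) (repr_pi_ae h) => x -> ->.
Qed.

Let integrable_vLfun (h : vLfunType mu (dual_exponent p)) (f : vLfunType mu p) :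
  mu.-integrable setT (EFin \o (fun x => f x * h x)).
Proof. exact: (vLfun_integrableM p_fin (vLfun_funP f) (vLfun_funP h)). Qed.

Let integrableZ_vLfun (a : R) (h : vLfunType mu (dual_exponent p)) (f : vLfunType mu p) :
  mu.-integrable setT (EFin \o (fun x => a * (f x * h x))).
Proof.
by have := integrableZl measurableT a (integrable_vLfun h f); apply: eq_integrable.
Qed.

Lemma pairing_linearr H : linear (pairing H : V -> R^o).
Proof.
move=> a F G; rewrite -[F]reprK -[G]reprK -[H]reprK.
rewrite -[a *: _](quot_piZ (vL_null_subspace mu p)).
rewrite -[_ + _](quot_piD (vL_null_subspace mu p)) !pairing_pi.
set h := repr H; set f : vLfunType mu p := repr F; set g : vLfunType mu p := repr G.
transitivity (\int[mu]_x (a * (f x * h x) + g x * h x)).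
  by apply: eq_Rintegral => x _; rewrite mulrA -mulrDl.
by rewrite RintegralD// RintegralZl.
Qed.

Lemma pairing_linearl F : linear (pairing^~ F : V' -> R^o).
Proof.
move=> a H K; rewrite -[H]reprK -[K]reprK -[F]reprK.
rewrite -[a *: _](quot_piZ (vL_null_subspace mu (dual_exponent p))).
rewrite -[_ + _](quot_piD (vL_null_subspace mu (dual_exponent p))) !pairing_pi.
set f := repr F; set h : vLfunType mu (dual_exponent p) := repr H.
set k : vLfunType mu (dual_exponent p) := repr K.
transitivity (\int[mu]_x (a * (f x * h x) + f x * k x)).
  by apply: eq_Rintegral => x _; rewrite mulrCA -mulrDr.
by rewrite RintegralD// RintegralZl.
Qed.

Lemma pairing_le H F : `|pairing H F| <= 2 * `|H| * `|F|.
Proof. by rewrite mulrAC; exact: (hoelder_Rintegral p_fin (vLfun_funP _) (vLfun_funP _)). Qed.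

Lemma pairing_bounded H : bounded_map (pairing H : V -> R^o).
Proof. by exists (2 * `|H|); exact: pairing_le. Qed.

Definition pairing_functional H : dual V :=
  mk_dual (pairing_linearr H) (pairing_bounded H).

Lemma bounded_exponent_vLb (f : vLfunType mu p) :
  (exists M : R, forall x, f x != 0 -> (p x <= M%:E)%E) -> vLb (\pi_V f).
Proof. by move=> [M fM]; apply/vLbP; exists M; exact: nearW. Qed.

Lemma germ_vLb F : vLb F -> germ F = 0.
Proof.
move=> Fb; apply: (@quotient_map_eq0 R V (closure_subspace (vLb_subspace mu p))).
exact: subset_closure.
Qed.

(** This is [luxemburg_dual_le] with constant [|phi| + e / 4]; the added term keeps the constant
    positive when [phi = 0]. *)
Lemma norm_density_le (phi : dual V) (H : V') :
  (forall F, vLb F -> phi F = pairing H F) -> `|H| <= 4 * `|phi|.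
Proof.
move=> phiH; apply/ler_addgt0Pr => e e0.
have e40 : 0 < e / 4 by rewrite divr_gt0.
have C0 : 0 < `|phi| + e / 4 by rewrite ltr_wpDl.
rewrite (_ : _ + e = 4 * (`|phi| + e / 4)); last by rewrite mulrDr mulrCA divff ?mulr1.
apply: (luxemburg_dual_le p_fin (vLfun_funP (repr H)) C0) => f fV fM.
pose f' := VLfun fV.
rewrite -(pairing_pi (repr H) f') reprK -phiH; last exact: bounded_exponent_vLb.
rewrite (le_trans (ler_norm _))// (le_trans (ler_dual_norm _ _))//.
rewrite [X in _ * X](vL_normE f') ler_wpM2r//; last by rewrite lerDl ltW.
exact: luxemburg_ge0.
Qed.

Definition functional_of (z : (V' * E)%type) : V -> R^o :=
  fun F => pairing z.1 F + z.2 (germ F).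

Lemma functional_of_linear z : linear (functional_of z).
Proof.
move=> a F G; rewrite /functional_of pairing_linearr germ_linear dual_linear.
by rewrite scalerDr addrACA.
Qed.

(** The norm of the direct sum is a maximum; Hoelder's inequality contributes 2 and the germ part
    1. *)
Lemma functional_of_le z F : `|functional_of z F| <= (3 * `|z|) * `|F|.
Proof.
rewrite (le_trans (ler_normD _ _))//.
have z1 : `|z.1| <= `|z| by rewrite prod_normE le_max lexx.
have z2 : `|z.2| <= `|z| by rewrite prod_normE le_max lexx orbT.
have -> : 3 * `|z| * `|F| = 2 * `|z| * `|F| + `|z| * `|F| by ring.
rewrite lerD//.
  by rewrite (le_trans (pairing_le _ _))// ler_wpM2r// ler_wpM2l.
rewrite (le_trans (ler_dual_norm _ _))// ler_pM//.
exact: quotient_map_norm.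
Qed.

Lemma functional_of_bounded z : bounded_map (functional_of z).
Proof. by exists (3 * `|z|); exact: functional_of_le. Qed.

Definition functional_of_dual (z : (V' * E)%type) : dual V :=
  mk_dual (functional_of_linear z) (functional_of_bounded z).

Lemma functional_of_dual_linear : linear functional_of_dual.
Proof.
move=> a y z; apply: val_inj; apply/funext => F.
rewrite -[LHS]/(pairing (a *: y.1 + z.1) F + (a *: y.2 + z.2) (germ F)).
rewrite -[RHS]/(a * (pairing y.1 F + y.2 (germ F)) + (pairing z.1 F + z.2 (germ F))).
rewrite (pairing_linearl F a y.1 z.1) mulrDr addrACA.
by [].
Qed.

Lemma functional_of_dual_vLb z F : vLb F -> functional_of_dual z F = pairing z.1 F.
Proof. by move=> /germ_vLb Fb; rewrite /= /functional_of Fb dual0 addr0. Qed.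

(** On [L_b] only the first component acts, so its norm is at most [4 |phi|]. The second is [phi]
    minus the pairing, bounded by [|phi| + 2 (4 |phi|) = 9 |phi|]. *)
Lemma norm_le_functional_of_dual z : `|z| <= 9 * `|functional_of_dual z|.
Proof.
set phi := functional_of_dual z.
have z1 : `|z.1| <= 4 * `|phi|.
  by apply: norm_density_le => F; exact: functional_of_dual_vLb.
rewrite prod_normE ge_max (le_trans z1) ?ler_wpM2r ?ler_nat//=.
apply: dual_norm_le; first exact: mulr_ge0.
apply: quotient_bound => F.
have -> : z.2 (germ F) = phi F - pairing z.1 F.
  by rewrite /phi /= /functional_of addrAC subrr add0r.
rewrite (le_trans (ler_normB _ _))//.
have -> : 9 * `|phi| * `|F| = `|phi| * `|F| + 2 * (4 * `|phi|) * `|F| by ring.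
rewrite lerD ?ler_dual_norm// (le_trans (pairing_le _ _))//.
by rewrite ler_wpM2r// ler_wpM2l.
Qed.

Lemma functional_of_dual_surj (phi : dual V) : exists z, functional_of_dual z = phi.
Proof.
(* The representation theorem takes a map on all functions; outside [L^p] this one evaluates [phi]
   at the default 0. *)
pose Phi (f : T -> R) : R := phi (\pi_V (insubd (0 : vLfunType mu p) f)).
have PhiE (f : T -> R) (fV : f \in vLfun mu p) : Phi f = phi (\pi_V (VLfun fV)).
  by rewrite /Phi; congr (phi (\pi_V _)); apply: val_inj; rewrite val_insubd fV.
have Phi_linear (a : R) (f g : T -> R) : f \in vLfun mu p -> g \in vLfun mu p ->
    Phi (fun x => a * f x + g x) = a * Phi f + Phi g.
  move=> fV gV.
  have fgV : (fun x => a * f x + g x) \in vLfun mu p.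
    exact: ((vLfun_submod_closed mu p).2 a f g fV gV).
  rewrite !PhiE -[RHS]/(a *: _ + _ : R^o) -dual_linear; congr (dual_fun phi).
  rewrite -[a *: _](quot_piZ (vL_null_subspace mu p)).
  rewrite -[RHS](quot_piD (vL_null_subspace mu p)).
  by congr (\pi_V _); apply: val_inj.
have Phi_bounded (f : T -> R) : f \in vLfun mu p ->
    `|Phi f| <= `|phi| * luxemburg mu p f.
  by move=> fV; rewrite PhiE (le_trans (ler_dual_norm _ _))// [X in _ * X](vL_normE (VLfun fV)).
have [h hV hE] := bounded_functional_representation p_fin Phi_linear Phi_bounded.
pose H : V' := \pi_V' (VLfun hV).
(* Representatives of elements of [L_b] are finite elements, where [h] represents [phi]. The
   difference then vanishes on the closure and descends to the germ space. *)
have phiH F : vLb F -> phi F - pairing_functional H F = 0.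
  rewrite -[F]reprK; set f : vLfunType mu p := repr F => /vLbP[M fM].
  have ff := bounded_exponent_finite_element p_fin (vLfun_funP f) fM.
  rewrite [X in _ - X](pairing_pi (VLfun hV) f) -hE// (PhiE _ (vLfun_funP f)).
  by apply/eqP; rewrite subr_eq0; apply/eqP; congr (phi (\pi_V _)); apply: val_inj.
have cH F : closure (@vLb d T R mu p) F -> (phi - pairing_functional H) F = 0.
  by apply: (@dual_closure0 _ _ (phi - pairing_functional H)) => G; exact: phiH.
have [psi psiE] := @dual_quotient_factor R V (closure_subspace (vLb_subspace mu p))
  (@closed_closure V (@vLb d T R mu p)) (phi - pairing_functional H) cH.
exists (H, psi); apply: val_inj; apply/funext => F.
rewrite -[LHS]/(pairing H F + psi (germ F)) [X in _ + X]psiE.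
by rewrite -[X in _ + X]/(phi F - pairing H F) addrC subrK.
Qed.

End germ_duality.

Theorem theorem2p1 (R : realType) (d : measure_display) (T : measurableType d)
    (mu : {sigma_finite_measure set T -> \bar R}) (p : exponent T R)
    (p_fin_ae : mu [set x | p x = +oo%E] = 0%E)
    (p_unbounded : exponent_sup mu p [set: T] = +oo%E) :
  isomorphic (dual (vLspace mu p))
    (vLspace mu (dual_exponent p) * dual (germ_space mu p))%type.
Proof.
(* Here 9 bounds the isomorphism onto the direct sum and 3 its inverse [functional_of_dual]. *)
apply: (@isomorphic_inverse _ _ _ _ 9 3 (functional_of_dual_linear p_fin_ae) _
  (norm_le_functional_of_dual p_fin_ae) (functional_of_dual_surj p_fin_ae)).
move=> z; apply: dual_norm_le; first exact: mulr_ge0.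
exact: functional_of_le.
Qed.
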